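(* Let $p\in(0,\infty)$, let $\phi_0\in\mathrm{Cvx}(\mathbb{R}^n)$, and let $\phi(t,x)$ be the solution with $\phi(0,\cdot)=\phi_0$ of $$\partial_t\phi=\Delta\phi-|D\phi|^2+\langle x,D\phi\rangle-n .$$ Write $\phi^{*,p}(t,\cdot)=(\phi(t,\cdot))^{*,p}$. Then, for $t>0$ and $y$ in the interior of $\{\phi^{*,p}(t,\cdot)<\infty\}$, $$\partial_t\phi^{*,p}(t,y)=\frac{p}{p+1}|y|^2-\langle y,D\phi^{*,p}(t,y)\rangle-\frac{I(d\phi^{p,y})}{p+1}+n,$$ where $d\phi^{p,y}$ is formed from $\phi(t,\cdot)$.
   Context: For $f:\mathbb{R}^n\to\mathbb{R}\cup\{\infty\}$ let $V(f)=\int_{\mathbb{R}^n}e^{-f(x)}\,dx$ (with $e^{-\infty}=0$). $\mathrm{Cvx}(\mathbb{R}^n)$ is the set of proper, convex, lower semi-continuous functions $\phi:\mathbb{R}^n\to\mathbb{R}\cup\{\infty\}$ with $0<V(\phi)<\infty$. For $f$ with $0<V(f)<\infty$, the $L^p$-Legendre transform is $$f^{*,p}(y)=\frac1p\log\int_{\mathbb{R}^n}e^{p(\langle x,y\rangle-f(x))}\frac{e^{-f(x)}\,dx}{V(f)}.$$ The solution considered is $$\phi(t,x)=-\log\int_{\mathbb{R}^n}e^{-\frac{|x-e^{-t}y|^2}{2(1-e^{-2t})}}\frac{e^{-\phi_0(y)}\,dy}{(2\pi(1-e^{-2t}))^{n/2}},\qquad t>0.$$ $D$ and $\Delta$ denote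 the spatial gradient and Laplacian. For $\phi=\phi(t,\cdot)$ at fixed $t$, $d\phi^{p,y}$ is the probability measure $$d\phi^{p,y}(x)=\frac{e^{p\langle x,y\rangle-(p+1)\phi(x)}\,dx}{\int_{\mathbb{R}^n}e^{p\langle z,y\rangle-(p+1)\phi(z)}\,dz}.$$ The Fisher information of a probability measure $\mu=f(x)\,dx$ is $I(\mu)=\int_{\mathbb{R}^n}|D\log f(x)|^2f(x)\,dx$. *)

(* Defs.v *)
From HB Require Import structures.
From mathcomp Require Import all_boot all_order all_algebra.
From mathcomp Require Import all_classical all_reals all_analysis.

Set Implicit Arguments.
Unset Strict Implicit.
Unset Printing Implicit Defensive.

Import Order.TTheory GRing.Theory Num.Theory.
Import numFieldNormedType.Exports.

Local Open Scope classical_set_scope.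
Local Open Scope ring_scope.
Local Open Scope ereal_scope.

(* Lebesgue measure on [R^n]: the library has it for [n = 1] and has binary
   product measures, so it is iterated here on [n]-tuples, whose sigma-algebra
   is the one generated by the coordinates. *)
Section lebesgue_cons.
Context {R : realType} {n : nat}.
Local Notation mR := (measurableTypeR R).

Definition tcons (x : mR * n.-tuple mR) : n.+1.-tuple mR :=
  [tuple of x.1 :: x.2].

Lemma measurable_tcons : measurable_fun [set: mR * n.-tuple mR] tcons.
Proof. exact: measurable_cons measurable_fst measurable_snd. Qed.

Variable mu : {sigma_finite_measure set (n.-tuple mR) -> \bar R}.

Definition lebesgue_cons : set (n.+1.-tuple mR) -> \bar R :=
  pushforward (@lebesgue_measure R \x mu) tcons.

Let lebesgue_cons0 : lebesgue_cons set0 = 0.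
Proof. by rewrite /lebesgue_cons /pushforward preimage_set0 measure0. Qed.

Let lebesgue_cons_ge0 A : 0 <= lebesgue_cons A.
Proof. by rewrite /lebesgue_cons /pushforward; exact: measure_ge0. Qed.

Let lebesgue_cons_sigma_additive : semi_sigma_additive lebesgue_cons.
Proof.
move=> F mF tF mUF; rewrite /lebesgue_cons /pushforward preimage_bigcup.
apply: measure_semi_sigma_additive.
- by move=> k; rewrite -[X in measurable X]setTI; exact: measurable_tcons.
- apply/trivIsetP => /= i j _ _ ij; rewrite -preimage_setI.
  by move/trivIsetP : tF => /(_ _ _ _ _ ij) ->//; rewrite preimage_set0.
- by rewrite -preimage_bigcup -[X in measurable X]setTI; exact: measurable_tcons.
Qed.

HB.instance Definition _ := isMeasure.Build _ _ _ lebesgue_cons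
  lebesgue_cons0 lebesgue_cons_ge0 lebesgue_cons_sigma_additive.

Let tuncons (t : n.+1.-tuple mR) : mR * n.-tuple mR :=
  (thead t, [tuple of behead t]).

Let tconsK : cancel tcons tuncons.
Proof. by move=> [x t]; congr (_, _); apply/val_inj. Qed.

Let measurable_tuncons : measurable_fun [set: n.+1.-tuple mR] tuncons.
Proof.
apply/measurable_fun_pairP; split.
  exact: (measurable_tnth ord0).
exact: measurable_behead.
Qed.

Let lebesgue_cons_sigma_finite : sigma_finite setT lebesgue_cons.
Proof.
have /sigma_finiteP[F [TF ndF Foo]] := sigma_finiteT (@lebesgue_measure R).
have /sigma_finiteP[G [TG ndG Goo]] := sigma_finiteT mu.
exists (fun k => tuncons @^-1` (F k `*` G k)).
  rewrite -preimage_bigcup (_ : \bigcup_k (F k `*` G k) = setT) ?preimage_setT//.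
  rewrite -setXTT TF TG predeqE => -[x y]; split.
    by move=> [k _ []/= ? ?]; split; exists k.
  move=> [/= [k _ Fkx] [l _ Gly]]; exists (maxn k l) => //; split.
  - by move: x Fkx; exact/subsetPset/ndF/leq_maxl.
  - by move: y Gly; exact/subsetPset/ndG/leq_maxr.
move=> k; have [mF Fk] := Foo k; have [mG Gk] := Goo k; split.
  rewrite -[X in measurable X]setTI; apply: measurable_tuncons => //.
  exact: measurableX.
rewrite /lebesgue_cons /pushforward -comp_preimage.
rewrite (_ : tuncons \o tcons = id); last by apply/funext => x; exact: tconsK.
by rewrite preimage_id product_measure1E// lte_mul_pinfty// ge0_fin_numE.
Qed.

HB.instance Definition _ := Measure_isSigmaFinite.Build _ _ _ lebesgue_cons
  lebesgue_cons_sigma_finite.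

End lebesgue_cons.

Fixpoint lebesgue_tuple {R : realType} (n : nat) :
    {sigma_finite_measure set (n.-tuple (measurableTypeR R)) -> \bar R} :=
  match n with
  | 0 => @dirac _ (0.-tuple (measurableTypeR R)) [tuple] R
  | m.+1 => lebesgue_cons (lebesgue_tuple m)
  end.

(* [\int_(R^n) f(x) dx] for functions of row vectors, which carry the normed
   module structure. *)
Definition integral_rV {R : realType} {n : nat} (f : 'rV[R]_n -> \bar R) :
    \bar R :=
  \int[@lebesgue_tuple R n]_t f (\row_i (tnth t i : R)).

Section vector_calculus.
Context {R : realType} {n : nat}.
Implicit Types (x y : 'rV[R]_n) (f : 'rV[R]_n -> R).
Local Open Scope ring_scope.

Definition dotp x y : R := \sum_i x 0 i * y 0 i.

(* The library's norm on ['rV_n] is the sup norm, which is not meant here. *)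
Definition sqnorm x : R := dotp x x.

Definition partial (i : 'I_n) f x : R := 'D_(delta_mx 0 i) f x.

Definition grad f x : 'rV[R]_n := \row_i partial i f x.

Definition laplacian f x : R := \sum_i partial i (partial i f) x.

End vector_calculus.

Section functions.
Context {R : realType} {n : nat}.
Implicit Types (f phi : 'rV[R]_n -> \bar R) (x y : 'rV[R]_n) (p : R).

Definition V f : \bar R := integral_rV (fun x => expeR (- f x)).

(* In [\bar R], [0 * +oo = 0], so the endpoints [s = 0, 1] impose nothing. *)
Definition convex_ereal phi : Prop :=
  forall x y (s : R), (0 <= s <= 1)%R ->
    phi (s *: x + (1 - s) *: y)%R <= s%:E * phi x + (1 - s)%:E * phi y.

Record Cvx phi : Prop := MkCvx {
  Cvx_gtNy : forall x, phi x != -oo ;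
  Cvx_proper : exists x, phi x < +oo ;
  Cvx_convex : convex_ereal phi ;
  Cvx_lsc : lower_semicontinuous phi ;
  Cvx_V : 0 < V phi < +oo
}.

Definition lp_legendre p f y : \bar R :=
  p^-1%:E * lne (integral_rV (fun x =>
    expeR (p%:E * ((dotp x y)%:E - f x)) * (expeR (- f x) / V f))).

Definition fp_formula (phi0 : 'rV[R]_n -> \bar R) (t : R) x : \bar R :=
  let v := (1 - expR (- (2 * t)))%R in
  - lne (integral_rV (fun y =>
      (expR (- (sqnorm (x - expR (- t) *: y) / (2 * v))))%:E
      * (expeR (- phi0 y) / ((2 * pi * v) `^ (n%:R / 2))%:E))).

(* Classical solutions, for [t > 0], of
   [d_t phi = Lap phi - |D phi|^2 + <x, D phi> - n]; the values are finite
   there, so [fine] loses nothing. *)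
Record fp_equation (phi : R -> 'rV[R]_n -> \bar R) : Prop := MkFpEquation {
  fp_fin_num : forall (t : R) x, (0 < t)%R -> phi t x \is a fin_num ;
  fp_derivable_t : forall (t : R) x, (0 < t)%R ->
    derivable (fun s : R => fine (phi s x)) t 1 ;
  fp_derivable_x : forall (t : R) x (i : 'I_n), (0 < t)%R ->
    derivable (fun z => fine (phi t z)) x (delta_mx 0%R i) ;
  fp_derivable_xx : forall (t : R) x (i : 'I_n), (0 < t)%R ->
    derivable (partial i (fun z => fine (phi t z))) x (delta_mx 0%R i) ;
  fp_eq : forall (t : R) x, (0 < t)%R ->
    let phit := fun z => fine (phi t z) in
    (derive1 (fun s : R => fine (phi s x)) t =
     laplacian phit x - sqnorm (grad phit x) + dotp x (grad phit x) - n%:R)%R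
}.

(* The equation may have other solutions with the same initial datum: the one
   considered is given by the explicit kernel, and [fp_solution_eq] only records
   which equation it solves. *)
Record fp_solution (phi0 : 'rV[R]_n -> \bar R)
    (phi : R -> 'rV[R]_n -> \bar R) : Prop := MkFpSolution {
  fp_solution_0 : phi 0%R = phi0 ;
  fp_solution_formula : forall t : R, (0 < t)%R -> phi t = fp_formula phi0 t ;
  fp_solution_eq : fp_equation phi
}.

(* Density of the probability measure [d phi^{p,y}]. *)
Definition tilted_density p y phi x : \bar R :=
  let w := fun z => expeR ((p * dotp z y)%:E - (p + 1)%:E * phi z) in
  w x / integral_rV w.

(* Fisher information of the measure [f(x) dx], as a possibly infinite value. *)
Definition fisher_information (f : 'rV[R]_n -> R) : \bar R :=
  integral_rV (fun x => (sqnorm (grad (fun z => ln (f z)) x) * f x)%:E).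

End functions.

(* Main.v *)
Require Import Defs.
From HB Require Import structures.
From mathcomp Require Import all_boot all_order all_algebra.
From mathcomp Require Import all_classical all_reals all_analysis.
From mathcomp Require Import measurable_realfun ring lra.
Import Order.TTheory GRing.Theory Num.Theory.
Import numFieldNormedType.Exports.
Local Open Scope classical_set_scope.
Local Open Scope ring_scope.

Set Implicit Arguments.
Unset Strict Implicit.

(** Why the formula holds.

    The equation is the heat equation in disguise.  With
    [sigma = e^(2 t) - 1] and [h(sigma, .)] the convolution of [e^(- phi0)]
    with the Gaussian of variance [sigma],
      [e^(- phi(t, x)) = c(t) h(sigma, e^t x)],
    so after the substitution [xi = e^t x] and up to an explicit factor of [t],
    [e^(p phi^{*,p}(t, y))] is
      [M = int e^<xi, b> h(sigma, xi)^q dxi],  [q = p + 1],  [b = p e^(- t) y],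
    and the mass [V(phi(t, .))] is constant (lemmas [fp_formulaE],
    [V_fp_formula], [lp_legendreE]).  In the variables [(b, sigma)] nothing is
    rescaled any more, which is what makes uniform domination possible.

    Write [P = e^<xi, b> h^q] and [L_i = d_i h / h].  Differentiating [M] under
    the integral sign, the motion of [b] gives the term [<y, D phi^{*,p}>] and
    the motion of [sigma] gives [q int (d_sigma h / h) P], where
    [d_sigma h = Lap h / 2] up to the normalisation of the Gaussian.  Two
    integrations by parts, [int d_i P = 0] and [int d_i (L_i P) = 0]
    ([Rintegral_tilt1], [Rintegral_tilt2]), express [int L_i P] and
    [int (d_ii h / h) P] through [M] and [int L_i^2 P].  As the logarithmic
    derivative of the density [P / M] is [b_i + q L_i], the sum of the latter
    over [i] amounts to the Fisher information ([Rintegral_tiltt_fisher], [fisher_information_tilt]).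
    The rest is algebra ([time_derivative_algebra]).

    Two facts justify the analysis.  First, the set of [b] for which [M] is
    finite does not depend on [sigma]: it can only shrink as [sigma] grows
    because the unnormalised Gaussian increases with its variance, and it does
    not shrink because [h(sigma + tau, .)] is, up to a constant, a Gaussian
    average of [h(sigma, .)], so that Jensen's inequality bounds [M] at the
    larger variance by [M] at the smaller ([laplace_add_lty]).  Secondly, every derivative of the
    Gaussian of variance at most [s1] is bounded by a multiple of the Gaussian
    of variance [s2 > s1], even after a bounded translation
    ([gauss_dominated]); hence [h] and its derivatives near [sigma] are bounded
    by one function [N = h(s2, .)], and [e^<xi, b> N^q] is integrable, with
    exponential moments since [b] is interior to the domain.  These dominating
    functions allow every differentiation under the integral sign, in [sigma],
    in [b] and along translations; integration by parts is the translation
    invariance of the integral, differentiated ([Rintegral_rV_partial]). *)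

(** * Row vectors and the product sigma-algebra *)

Section tuples.
Context {R : realType}.
Local Notation mR := (measurableTypeR R).

Definition row_of {n} (t : n.-tuple mR) : 'rV[R]_n := \row_i (tnth t i : R).
Definition tuple_of_row {n} (x : 'rV[R]_n) : n.-tuple mR :=
  [tuple (x 0 i : mR) | i < n].

Lemma row_ofE n (t : n.-tuple mR) i : row_of t 0 i = tnth t i.
Proof. by rewrite mxE. Qed.

Lemma tuple_of_rowK n : cancel (@tuple_of_row n) row_of.
Proof. by move=> x; apply/rowP => i; rewrite row_ofE tnth_mktuple. Qed.

Lemma coord_le_norm n (x : 'rV[R]_n) i : `|x 0 i| <= `|x|.
Proof.
rewrite [leRHS]/Num.Def.normr/= mx_normrE.
by apply/bigmax_geP; right => /=; exists (0, i).
Qed.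

Lemma norm_le_coord n (x : 'rV[R]_n) (e : R) :
  0 <= e -> (forall i, `|x 0 i| <= e) -> `|x| <= e.
Proof.
move=> e0 H; rewrite [leLHS]/Num.Def.normr/= mx_normrE (bigmax_le _ e0)//=.
by move=> [i j] _ /=; rewrite (ord1 i).
Qed.

(** The norm and the derivatives live on row vectors, the Lebesgue measure on
    tuples: row vectors get no sigma-algebra of their own, and everything
    measure-theoretic about them is read through [row_of]. *)
Definition measurable_rV {n d} {U : measurableType d} (f : 'rV[R]_n -> U) :=
  measurable_fun [set: n.-tuple mR] (f \o row_of).

Lemma measurable_coord n (i : 'I_n) :
  measurable_rV ((fun x => x 0 i) : 'rV[R]_n -> mR).
Proof.
rewrite /measurable_rV (_ : _ \o _ = (@tnth _ mR ^~ i)); first exact: measurable_tnth.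
by apply/funext => t /=; rewrite row_ofE.
Qed.

Lemma measurable_tuple_of_row d n (T : measurableType d) (f : T -> 'rV[R]_n) :
  (forall i, measurable_fun setT (fun t => f t 0 i : mR)) ->
  measurable_fun setT (fun t => tuple_of_row (f t)).
Proof.
move=> mf; apply/measurable_fun_tnthP => i.
rewrite (_ : _ \o _ = fun t => f t 0 i : mR)//.
by apply/funext => t /=; rewrite tnth_mktuple.
Qed.

Lemma measurable_rV_comp d d' n (T : measurableType d) (U : measurableType d')
    (k : 'rV[R]_n -> U) (f : T -> 'rV[R]_n) :
  measurable_rV k -> (forall i, measurable_fun setT (fun t => f t 0 i : mR)) ->
  measurable_fun setT (fun t => k (f t)).
Proof.
move=> mk mf.
rewrite (_ : (fun t => k (f t)) = (k \o row_of) \o (fun t => tuple_of_row (f t))).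
  by apply: measurableT_comp => //; exact: measurable_tuple_of_row.
by apply/funext => t /=; rewrite tuple_of_rowK.
Qed.

(** Open sets of row vectors are countable unions of boxes with rational
    centres, which is why the product sigma-algebra sees them. *)
Lemma measurable_open_rV n (U : set 'rV[R]_n) :
  open U -> measurable (row_of @^-1` U).
Proof.
move=> oU.
pose box (q : n.-tuple rat) (k : nat) : set (n.-tuple mR) :=
  [set t | forall i, `|tnth t i - ratr (tnth q i)| < k.+1%:R^-1].
have mbox q k : measurable (box q k).
  rewrite (_ : box q k =
    \bigcap_(i in [set: 'I_n]) [set t | `|tnth t i - ratr (tnth q i)| < k.+1%:R^-1]).
    apply: fin_bigcap_measurable => // i _.
    rewrite (_ : [set t | _] = (@tnth _ mR ^~ i) @^-1`
      ([set r : R | `|r - ratr (tnth q i)| < k.+1%:R^-1] : set mR))//.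
    rewrite -[X in measurable X]setTI; apply: measurable_tnth => //.
    rewrite (_ : [set r | _] =
      `]ratr (tnth q i) - k.+1%:R^-1, ratr (tnth q i) + k.+1%:R^-1[%classic).
      exact: measurable_itv.
    by apply/seteqP; split => r /=; rewrite in_itv/= ltr_distl.
  by apply/seteqP; split => t /= Ht; [move=> i _; exact: Ht|move=> i; exact: (Ht i)].
pose B (k : nat) : set (n.-tuple mR) :=
  if unpickle k : option (n.-tuple rat * nat)%type is Some qk
  then if `[< box qk.1 qk.2 `<=` row_of @^-1` U >] then box qk.1 qk.2 else set0
  else set0.
have mB k : measurable (B k) by rewrite /B; case: unpickle => // qk; case: ifP.
rewrite (_ : _ @^-1` _ = \bigcup_k B k); last first.
  apply/seteqP; split => t /=.
    move=> Ut; move: oU; rewrite openE => /(_ _ Ut); rewrite /interior /=.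
    move=> /nbhs_ballP[e /= e0 eU].
    have [k ke] : exists k : nat, 2 * k.+1%:R^-1 < e.
      have [k _ Hk] := (@near_infty_natSinv_lt R (PosNum (divr_gt0 e0 (ltr0n R 2)))).
      exists k; have := Hk k (leqnn _); rewrite /= ltr_pdivlMr// mulrC; exact.
    have k0 : 0 < k.+1%:R^-1 :> R by rewrite invr_gt0.
    have H i : {q : rat | `|tnth t i - ratr q| < k.+1%:R^-1}.
      apply: cid; have [q] := rat_in_itvoo (ltr_pwDr k0 (lexx (tnth t i : R))).
      rewrite in_itv/= => /andP[h1 h2]; exists q.
      by rewrite distrC ger0_norm ?subr_ge0 ?(ltW h1)// ltrBlDl.
    pose q : n.-tuple rat := [tuple sval (H i) | i < n].
    have tq : box q k t by move=> i; rewrite tnth_mktuple; exact: (svalP (H i)).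
    exists (pickle (q, k)) => //; rewrite /B pickleK /=; case: asboolP => // -[].
    move=> t' t'q; apply: eU; rewrite -ball_normE /=.
    apply: (le_lt_trans _ ke); apply: norm_le_coord => [|j].
      by rewrite mulr_ge0 // ltW.
    rewrite !mxE (le_trans (ler_distD (ratr (tnth q j)) _ _))//.
    rewrite mulr_natl mulr2n; apply: lerD; apply: ltW; first exact: tq.
    by rewrite distrC; exact: t'q.
  move=> [k _]; rewrite /B; case: unpickle => // qk; case: asboolP => //.
  by move=> sub; exact: sub.
exact: bigcupT_measurable.
Qed.

(** The superlevel sets of a lower semi-continuous function are open. *)
Lemma measurable_lsc_rV n (f : 'rV[R]_n -> \bar R) :
  lower_semicontinuous f -> measurable_rV f.
Proof.
move=> /lower_semicontinuousP scif.
apply: (measurability _ (ErealGenOInfty.measurableE R)) => //.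
move=> _ [_ [a ->]] <-; rewrite setTI preimage_itvoy.
exact: measurable_open_rV (scif a).
Qed.
End tuples.

(** * Affine changes of variables *)

Section affine.
Context {R : realType}.
Local Notation mR := (measurableTypeR R).

(** The scaled push-forward of the Lebesgue measure has the right value on
    intervals, and these determine the Lebesgue measure. *)
Lemma ge0_integral_affine1 (c a : R) (f : mR -> \bar R) : 0 < c ->
  measurable_fun setT f -> (forall x, 0 <= f x)%E ->
  (\int[@lebesgue_measure R]_x f (c * x + a)%R =
   c^-1%:E * \int[@lebesgue_measure R]_x f x)%E.
Proof.
move=> c0 mf f0.
pose phi (x : mR) : mR := c * x + a.
have mphi : measurable_fun setT phi.
  by apply: measurable_funD => //; exact: measurable_funM.
have cN0 : (0 <= c)%R by exact: ltW.
have cV0 : (0 <= c^-1)%R by rewrite invr_ge0.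
pose nu : {measure set mR -> \bar R} :=
  mscale (NngNum cN0) (pushforward (@lebesgue_measure R) phi).
have E A : measurable A -> lebesgue_measure A = nu mphi A.
  apply: lebesgue_measure_unique => _ [[u v]] _ <-.
  rewrite /nu /= /mscale /= /pushforward.
  have -> : phi @^-1` [set` `]u, v]] = [set` `](u - a) / c, (v - a) / c]].
    apply/seteqP; split => x /=; rewrite !in_itv/= /phi;
    by rewrite ltr_pdivrMr// ler_pdivlMr// ltrBlDr lerBrDr mulrC.
  rewrite !lebesgue_measure_itv/= !lte_fin ltr_pM2r ?invr_gt0// ltrD2r.
  case: ifP => _; last by rewrite mule0.
  rewrite -!EFinD -EFinM; congr EFin.
  by field; rewrite gt_eqF.
transitivity (\int[pushforward (@lebesgue_measure R) phi]_x f x)%E.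
  by rewrite (ge0_integral_pushforward mphi).
have -> : (\int[@lebesgue_measure R]_x f x = \int[nu mphi]_x f x)%E.
  by apply: eq_measure_integral => A mA _; rewrite -E.
rewrite ge0_integral_mscale//= muleA -EFinM mulVf ?gt_eqF// mul1e.
by [].
Qed.

Lemma ge0_integral_lebesgue_tupleS n (f : n.+1.-tuple mR -> \bar R) :
  measurable_fun setT f -> (forall x, 0 <= f x)%E ->
  (\int[lebesgue_tuple n.+1]_t f t =
   \int[@lebesgue_measure R]_x \int[lebesgue_tuple n]_t f (tcons (x, t)))%E.
Proof.
move=> mf f0.
transitivity (\int[pushforward (@lebesgue_measure R \x lebesgue_tuple n)%E (@tcons R n)]_t f t)%E.
  by [].
rewrite (ge0_integral_pushforward (@measurable_tcons R n))//=.
rewrite preimage_setT.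
rewrite (fubini_tonelli1 (f \o @tcons R n))//.
  exact: measurableT_comp (@measurable_tcons R n).
by move=> x; exact: f0.
Qed.

Lemma tuple_of_row_affine_cons n (c : R) (a : 'rV[R]_n.+1) x (t : n.-tuple mR) :
  tuple_of_row (c *: row_of (tcons (x, t)) + a) =
  tcons (c * x + a 0 ord0,
    tuple_of_row (c *: row_of t + \row_i a 0 (lift ord0 i))).
Proof.
apply: eq_from_tnth => i; rewrite tnth_mktuple !mxE.
case: (unliftP ord0 i) => [j|] ->; last by rewrite !tnth0.
by rewrite !tnthS tnth_mktuple !mxE.
Qed.

Lemma measurable_affine n (c : R) (a : 'rV[R]_n) :
  measurable_fun setT (fun t : n.-tuple mR => tuple_of_row (c *: row_of t + a)).
Proof.
apply: measurable_tuple_of_row => i.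
under eq_fun do rewrite !mxE.
apply: measurable_funD => //; apply: measurable_funM => //.
exact: measurable_tnth.
Qed.

(** The same dilation acts on every coordinate, so that Tonelli's theorem
    reduces the statement, one coordinate at a time, to the real line. *)
Lemma ge0_integral_tuple_affine n (c : R) (a : 'rV[R]_n)
    (f : n.-tuple mR -> \bar R) : 0 < c ->
  measurable_fun setT f -> (forall x, 0 <= f x)%E ->
  (\int[lebesgue_tuple n]_t f (tuple_of_row (c *: row_of t + a)) =
   (c ^- n)%:E * \int[lebesgue_tuple n]_t f t)%E.
Proof.
move=> c0; elim: n a f => [|n IH] a f mf f0.
  rewrite expr0 invr1 mul1e; apply: eq_integral => t _.
  by congr f; rewrite (tuple0 t) [LHS]tuple0.
rewrite ge0_integral_lebesgue_tupleS//; last first.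
  exact: (measurableT_comp mf (measurable_affine c a)).
have mfx x : measurable_fun setT (fun t => f (tcons (x, t))).
  apply: (measurableT_comp mf).
  exact: (measurableT_comp (@measurable_tcons R n) (pair1_measurable x)).
have mF : measurable_fun setT (fun x => \int[lebesgue_tuple n]_t f (tcons (x, t)))%E.
  apply: (measurable_fun_fubini_tonelli_F (f \o @tcons R n)).
    exact: measurableT_comp mf (@measurable_tcons R n).
  by move=> x; exact: f0.
transitivity (\int[@lebesgue_measure R]_x ((c ^- n)%:E *
    \int[lebesgue_tuple n]_t f (tcons ((c * x + a 0 ord0)%R, t))))%E.
  apply: eq_integral => x _.
  rewrite -(IH (\row_i a 0 (lift ord0 i)) (fun t => f (tcons (c * x + a 0 ord0, t))))//.
  by apply: eq_integral => t _; rewrite tuple_of_row_affine_cons.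
rewrite ge0_integralZl//; last 3 first.
- by apply: measurableT_comp mF _; apply: measurable_funD => //; exact: measurable_funM.
- by move=> x _; apply: integral_ge0.
- by rewrite lee_fin invr_ge0 exprn_ge0// ltW.
rewrite (ge0_integral_affine1 _ c0 mF); last by move=> x; apply: integral_ge0.
by rewrite muleA -EFinM -invfM -exprSr (ge0_integral_lebesgue_tupleS mf).
Qed.

End affine.

(** * The inner product, Tonelli and the Gaussian integral *)

Section dot.
Context {R : realType} {n : nat}.
Implicit Types (x y z : 'rV[R]_n) (c : R).

Lemma dotpC x y : dotp x y = dotp y x.
Proof. by apply: eq_bigr => i _; rewrite mulrC. Qed.

Lemma dotpDl x y z : dotp (x + y) z = dotp x z + dotp y z.
Proof. by rewrite /dotp -big_split; apply: eq_bigr => i _; rewrite mxE mulrDl. Qed.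

Lemma dotpZl c x y : dotp (c *: x) y = c * dotp x y.
Proof. by rewrite /dotp mulr_sumr; apply: eq_bigr => i _; rewrite mxE mulrA. Qed.

Lemma dotpDr x y z : dotp z (x + y) = dotp z x + dotp z y.
Proof. by rewrite !(dotpC z) dotpDl. Qed.

Lemma dotpZr c x y : dotp y (c *: x) = c * dotp y x.
Proof. by rewrite !(dotpC y) dotpZl. Qed.

Lemma dotp_delta x i : dotp x (delta_mx 0 i) = x 0 i.
Proof.
rewrite /dotp (bigD1 i)//= mxE !eqxx mulr1 big1 ?addr0// => j /negbTE ji.
by rewrite mxE ji andbF mulr0.
Qed.

Lemma dotp0l x : dotp 0 x = 0.
Proof. by rewrite -(scale0r 0) dotpZl mul0r. Qed.

Lemma dotpNl x y : dotp (- x) y = - dotp x y.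
Proof. by rewrite -scaleN1r dotpZl mulN1r. Qed.

Lemma sqnormD x y : sqnorm (x + y) = sqnorm x + 2 * dotp x y + sqnorm y.
Proof. by rewrite /sqnorm dotpDl !dotpDr (dotpC y x); ring. Qed.

Lemma sqnormZ c x : sqnorm (c *: x) = c ^+ 2 * sqnorm x.
Proof. by rewrite /sqnorm dotpZl dotpZr mulrA. Qed.

Lemma sqnormN x : sqnorm (- x) = sqnorm x.
Proof. by rewrite -scaleN1r sqnormZ sqrrN expr1n mul1r. Qed.

Lemma sqnormB x y : sqnorm (x - y) = sqnorm x - 2 * dotp x y + sqnorm y.
Proof. by rewrite sqnormD sqnormN dotpC dotpNl dotpC mulrN. Qed.

Lemma sqnorm_ge0 x : 0 <= sqnorm x.
Proof. by apply: sumr_ge0 => i _; rewrite -expr2 sqr_ge0. Qed.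

Lemma coord_sqr_le x i : x 0 i ^+ 2 <= sqnorm x.
Proof.
rewrite /sqnorm /dotp (bigD1 i)//= expr2 lerDl.
by apply: sumr_ge0 => j _; rewrite -expr2 sqr_ge0.
Qed.

Lemma dotp_le_norm x y : `|dotp x y| <= n%:R * `|y| * `|x|.
Proof.
rewrite (le_trans (ler_norm_sum _ _ _))//.
rewrite (@le_trans _ _ (\sum_(i < n) `|y| * `|x|))//.
  by apply: ler_sum => i _; rewrite normrM mulrC ler_pM// coord_le_norm.
by rewrite sumr_const card_ord -mulrA mulr_natl.
Qed.

End dot.

Section integrals.
Context {R : realType}.
Local Notation mR := (measurableTypeR R).
Local Notation leb := (@lebesgue_tuple R).

Definition integrable_rV {n} (f : 'rV[R]_n -> R) :=
  (leb n).-integrable setT (fun t => (f (row_of t))%:E).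

Definition Rintegral_rV {n} (f : 'rV[R]_n -> R) : R := \int[leb n]_t f (row_of t).

Lemma ge0_integral_rV_affine n (c : R) (a : 'rV[R]_n) (f : 'rV[R]_n -> \bar R) :
  0 < c -> measurable_rV f -> (forall x, 0 <= f x)%E ->
  integral_rV (fun x => f (c *: x + a)) = ((c ^- n)%:E * integral_rV f)%E.
Proof.
move=> c0 mf f0.
rewrite -[RHS](ge0_integral_tuple_affine a c0 mf) => [|x]; last exact: f0.
by apply: eq_integral => t _ /=; rewrite tuple_of_rowK.
Qed.

Lemma measurable_rV_affine d (U : measurableType d) n (c : R) (a : 'rV[R]_n)
    (f : 'rV[R]_n -> U) :
  measurable_rV f -> measurable_rV (fun x => f (c *: x + a)).
Proof.
move=> mf; apply: (measurable_rV_comp mf) => i.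
under eq_fun do rewrite !mxE.
apply: measurable_funD => //; apply: measurable_funM => //.
exact: measurable_tnth.
Qed.

Lemma measurable_rV_shift d (U : measurableType d) n (a : 'rV[R]_n)
    (f : 'rV[R]_n -> U) :
  measurable_rV f -> measurable_rV (fun x => f (x + a)).
Proof.
move=> mf; have := measurable_rV_affine 1 a mf.
by under eq_fun do rewrite scale1r.
Qed.

Lemma integrable_rV_affine n (c : R) (a : 'rV[R]_n) (f : 'rV[R]_n -> R) :
  0 < c -> integrable_rV f -> integrable_rV (fun x => f (c *: x + a)).
Proof.
move=> c0 /integrableP[mf fi]; apply/integrableP; split.
  exact: (@measurable_rV_affine _ (\bar R) n c a (fun x => (f x)%:E)).
have := @ge0_integral_rV_affine n c a (fun x => `|(f x)%:E|)%E c0.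
rewrite /integral_rV => -> //.
  by rewrite lte_mul_pinfty// lee_fin invr_ge0 exprn_ge0// ltW.
by apply: (measurableT_comp _ mf); exact: abse_measurable.
Qed.

Lemma Rintegral_rV_affine n (c : R) (a : 'rV[R]_n) (f : 'rV[R]_n -> R) :
  0 < c -> integrable_rV f ->
  Rintegral_rV (fun x => f (c *: x + a)) = c ^- n * Rintegral_rV f.
Proof.
move=> c0 fi.
have mf : measurable_rV (fun x => (f x)%:E) by case/integrableP : fi.
rewrite /Rintegral_rV /Rintegral -[in RHS](@fineM _ (c ^- n)%:E)//; last first.
  exact: integrable_fin_num.
congr fine; rewrite integralE [in RHS]integralE muleBr//; last first.
  by apply: fin_num_adde_defr; exact: integrable_pos_fin_num.
congr (_ - _)%E.
  transitivity (integral_rV (fun x => maxe (f (c *: x + a))%:E 0)%E).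
    by apply: eq_integral => t _; rewrite funeposE.
  rewrite (@ge0_integral_rV_affine n c a (fun x => maxe (f x)%:E 0)%E c0).
  - by congr (_ * _)%E; apply: eq_integral => t _; rewrite funeposE.
  - by apply: measurable_maxe => //; exact: mf.
  - by move=> x; rewrite le_max lexx orbT.
transitivity (integral_rV (fun x => maxe (- (f (c *: x + a))%:E) 0)%E).
  by apply: eq_integral => t _; rewrite funenegE.
rewrite (@ge0_integral_rV_affine n c a (fun x => maxe (- (f x)%:E) 0)%E c0).
- by congr (_ * _)%E; apply: eq_integral => t _; rewrite funenegE.
- by apply: measurable_maxe => //; apply: measurableT_comp => //; exact: mf.
- by move=> x; rewrite le_max lexx orbT.
Qed.

Lemma tonelli_rV n m (f : 'rV[R]_n -> 'rV[R]_m -> \bar R) :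
  measurable_fun setT (fun z => f (row_of z.1) (row_of z.2)) ->
  (forall x y, 0 <= f x y)%E ->
  integral_rV (fun x => integral_rV (f x)) =
  integral_rV (fun y => integral_rV (f ^~ y)).
Proof.
move=> mf f0.
have := @fubini_tonelli _ _ _ _ R (leb n) (leb m)
  (fun z => f (row_of z.1) (row_of z.2)) mf.
by apply => z; exact: f0.
Qed.

Lemma measurable_tonelli_rV n m (f : 'rV[R]_n -> 'rV[R]_m -> \bar R) :
  measurable_fun setT (fun z => f (row_of z.1) (row_of z.2)) ->
  (forall x y, 0 <= f x y)%E ->
  measurable_rV (fun x => integral_rV (f x)).
Proof.
move=> mf f0.
apply: (measurable_fun_fubini_tonelli_F (fun z => f (row_of z.1) (row_of z.2))) => //.
Qed.

(** The normalising factor [(2 pi s)^(- n / 2)] is left out so that the kernel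
    increases with its variance: this monotonicity passes to every integral
    built from it. *)
Definition gauss {n} (s : R) (x : 'rV[R]_n) : R := expR (- (sqnorm x / (2 * s))).

Lemma gauss_ge0 n s (x : 'rV[R]_n) : 0 <= gauss s x.
Proof. exact: expR_ge0. Qed.

Lemma measurable_dotp n (a : 'rV[R]_n) : measurable_rV (fun x => dotp x a : R).
Proof.
apply: measurable_sum => i; apply: measurable_funM => //.
exact: measurable_coord.
Qed.

Lemma measurable_sqnorm n : measurable_rV (@sqnorm R n).
Proof. by apply: measurable_sum => i; apply: measurable_funM; exact: measurable_coord. Qed.

Lemma measurable_gauss n s : measurable_rV (@gauss n s).
Proof.
apply: (measurableT_comp (@measurable_expR R)).
apply: measurableT_comp => //; apply: measurable_funM => //.
exact: measurable_sqnorm.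
Qed.

(** The variance [1 / 2] is the one of [gauss_fun], and the density is a product
    over the coordinates. *)
Let integral_gauss2 n :
  integral_rV (fun x => (@gauss n 2^-1 x)%:E) = ((Num.sqrt pi) ^+ n)%:E.
Proof.
have mg k : measurable_fun setT (fun t => (@gauss k 2^-1 (row_of t))%:E).
  by apply/measurable_EFinP; exact: measurable_gauss.
rewrite /integral_rV; elim: n => [|n IH].
  rewrite integral_dirac//= ?diracT ?mul1e; last first.
    exact: mg.
  by rewrite /gauss /sqnorm /dotp big_ord0 mul0r oppr0 expR0 expr0.
rewrite (ge0_integral_lebesgue_tupleS
  (f := fun t => (@gauss n.+1 2^-1 (row_of t))%:E)); last 2 first.
- exact: mg.
- by move=> t; rewrite lee_fin gauss_ge0.
transitivity (\int[@lebesgue_measure R]_x ((Num.sqrt pi) ^+ n * gauss_fun x)%:E)%E.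
  apply: eq_integral => x _; rewrite mulrC EFinM -IH -ge0_integralZl_EFin//; last 3 first.
  - by move=> t _; rewrite lee_fin gauss_ge0.
  - exact: mg.
  - exact: expR_ge0.
  apply: eq_integral => t _; rewrite -EFinM -expRD; congr (expR _)%:E.
  rewrite divff// !divr1 -opprD; congr (- _).
  rewrite /sqnorm /dotp big_ord_recl !row_ofE tnth0 expr2; congr (_ + _).
  by apply: eq_bigr => i _; rewrite !row_ofE tnthS.
under eq_integral do rewrite EFinM.
rewrite ge0_integralZl//; last 2 first.
- apply/measurable_EFinP; apply: measurable_funTS; exact: measurable_gauss_fun.
- by move=> x _; rewrite lee_fin gauss_fun_ge0.
by rewrite integralT_gauss -EFinM exprSr.
Qed.

Lemma integral_gauss n s (m : 'rV[R]_n) : 0 < s ->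
  integral_rV (fun x => (gauss s (x - m))%:E) = (Num.sqrt (2 * pi * s) ^+ n)%:E.
Proof.
move=> s0; pose c := (Num.sqrt (2 * s))^-1.
have s20 : 0 < Num.sqrt (2 * s) by rewrite sqrtr_gt0 mulr_gt0.
have c0 : 0 < c by rewrite invr_gt0.
transitivity (integral_rV (fun x => (gauss 2^-1 (c *: x + (- c *: m)))%:E)).
  apply: eq_integral => t _; congr (expR (- _))%:E.
  rewrite scaleNr -scalerBr sqnormZ divff// divr1 mulrC /c exprVn sqr_sqrtr//.
  by rewrite mulr_ge0// ltW.
rewrite (@ge0_integral_rV_affine _ c (- c *: m) (fun x => (gauss 2^-1 x)%:E))//; last 2 first.
- by apply/measurable_EFinP; exact: measurable_gauss.
- by move=> x; rewrite lee_fin gauss_ge0.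
rewrite integral_gauss2 -EFinM /c exprVn invrK -exprMn -sqrtrM ?mulr_ge0 ?(ltW s0)//.
by congr ((Num.sqrt _) ^+ _)%:E; ring.
Qed.

End integrals.

(** * Integrals of real functions of row vectors *)

Section Rintegral.
Context {R : realType} {n : nat}.
Implicit Types (f g : 'rV[R]_n -> R).

Lemma integrable_rV_measurable f : integrable_rV f -> measurable_rV f.
Proof. by move=> /integrableP[/measurable_EFinP]. Qed.

Lemma le_integrable_rV f g : measurable_rV f -> integrable_rV g ->
  (forall x, `|f x| <= g x) -> integrable_rV f.
Proof.
move=> mf ig fg; apply: (le_integrable _ _ _ ig) => //.
  by apply/measurable_EFinP; exact: mf.
move=> t _ /=; rewrite lee_fin (le_trans (fg _))// ler_norm//.
Qed.

Lemma integrable_rVZl (c : R) f :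
  integrable_rV f -> integrable_rV (fun x => c * f x).
Proof.
move=> fi; rewrite /integrable_rV; under eq_fun do rewrite EFinM.
exact: integrableZl.
Qed.

Lemma integrable_rVD f g : integrable_rV f -> integrable_rV g ->
  integrable_rV (fun x => f x + g x).
Proof.
move=> fi gi; rewrite /integrable_rV; under eq_fun do rewrite EFinD.
exact: integrableD.
Qed.

Lemma integrable_rV_sum (I : finType) (F : I -> 'rV[R]_n -> R) :
  (forall i, integrable_rV (F i)) -> integrable_rV (fun x => \sum_i F i x).
Proof.
move=> Fi; rewrite /integrable_rV; under eq_fun do rewrite -sumEFin.
by apply: integrable_sum => // i _; exact: Fi.
Qed.

Lemma ge0_integrable_rV f : measurable_rV f -> (forall x, 0 <= f x) ->
  (integral_rV (fun x => (f x)%:E) < +oo)%E -> integrable_rV f.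
Proof.
move=> mf f0 fi; apply/integrableP; split; first by apply/measurable_EFinP.
by under eq_integral => t _ do rewrite gee0_abs ?lee_fin//.
Qed.

Lemma eq_integral_rV (F G : 'rV[R]_n -> \bar R) : F =1 G -> integral_rV F = integral_rV G.
Proof. by move=> /funext->. Qed.

Lemma ge0_integral_rVZl (c : R) f : 0 <= c -> measurable_rV f ->
  (forall x, 0 <= f x) ->
  integral_rV (fun x => (c * f x)%:E) = (c%:E * integral_rV (fun x => (f x)%:E))%E.
Proof.
move=> c0 mf f0; rewrite /integral_rV -ge0_integralZl_EFin//.
  by move=> t _; rewrite lee_fin.
by apply/measurable_EFinP; exact: mf.
Qed.

Lemma ge0_integral_rVD f g : measurable_rV f -> measurable_rV g ->
  (forall x, 0 <= f x) -> (forall x, 0 <= g x) ->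
  integral_rV (fun x => (f x + g x)%:E) =
  (integral_rV (fun x => (f x)%:E) + integral_rV (fun x => (g x)%:E))%E.
Proof.
move=> mf mg f0 g0; rewrite /integral_rV -ge0_integralD//.
- by move=> t _; rewrite lee_fin.
- by apply/measurable_EFinP; exact: mf.
- by move=> t _; rewrite lee_fin.
- by apply/measurable_EFinP; exact: mg.
Qed.

Lemma ge0_le_integral_rV f g : measurable_rV f -> measurable_rV g ->
  (forall x, 0 <= f x) -> (forall x, f x <= g x) ->
  (integral_rV (fun x => (f x)%:E) <= integral_rV (fun x => (g x)%:E))%E.
Proof.
move=> mf mg f0 fg; apply: ge0_le_integral => //.
- by move=> t _; rewrite lee_fin.
- by apply/measurable_EFinP; exact: mf.
- by apply/measurable_EFinP; exact: mg.
- by move=> t _; rewrite lee_fin.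
Qed.

Lemma EFin_Rintegral_rV f : integrable_rV f ->
  (Rintegral_rV f)%:E = integral_rV (fun x => (f x)%:E).
Proof. by move=> fi; rewrite /Rintegral_rV /Rintegral fineK//; exact: integrable_fin_num. Qed.

Lemma eq_Rintegral_rV f g : f =1 g -> Rintegral_rV f = Rintegral_rV g.
Proof. by move=> fg; congr (Rintegral_rV _); apply/funext. Qed.

Lemma Rintegral_rVZl (c : R) f : integrable_rV f ->
  Rintegral_rV (fun x => c * f x) = c * Rintegral_rV f.
Proof. by move=> fi; rewrite /Rintegral_rV RintegralZl. Qed.

Lemma Rintegral_rVD f g : integrable_rV f -> integrable_rV g ->
  Rintegral_rV (fun x => f x + g x) = Rintegral_rV f + Rintegral_rV g.
Proof. by move=> fi gi; rewrite /Rintegral_rV RintegralD. Qed.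

Lemma Rintegral_rV0 : Rintegral_rV (fun _ : 'rV[R]_n => 0) = 0.
Proof. by rewrite /Rintegral_rV /Rintegral integral0. Qed.

Lemma Rintegral_rV_sum (I : finType) (F : I -> 'rV[R]_n -> R) :
  (forall i, integrable_rV (F i)) ->
  Rintegral_rV (fun x => \sum_i F i x) = \sum_i Rintegral_rV (F i).
Proof.
move=> Fi.
have H s : integrable_rV (fun x => \sum_(i <- s) F i x) /\
   Rintegral_rV (fun x => \sum_(i <- s) F i x) = \sum_(i <- s) Rintegral_rV (F i).
  elim: s => [|i s [IH1 IH2]].
    under eq_fun do rewrite big_nil; rewrite big_nil Rintegral_rV0; split => //.
    exact: integrable0.
  under eq_fun do rewrite big_cons; rewrite big_cons; split.
    exact: integrable_rVD.
  by rewrite Rintegral_rVD// IH2.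
by have [] := H (index_enum I).
Qed.

Lemma le_Rintegral_rV f g : integrable_rV f -> integrable_rV g ->
  (forall x, f x <= g x) -> Rintegral_rV f <= Rintegral_rV g.
Proof. by move=> fi gi fg; apply: le_Rintegral => // t _; exact: fg. Qed.

Lemma norm_Rintegral_rV f g : measurable_rV f -> integrable_rV g ->
  (forall x, `|f x| <= g x) -> `|Rintegral_rV f| <= Rintegral_rV g.
Proof.
move=> mf gi fg; have fi := le_integrable_rV mf gi fg.
apply: (le_trans (le_normr_Rintegral _ _)) => //.
rewrite /Rintegral_rV; apply: le_Rintegral => //; last exact: (integrable_norm fi).
Qed.

(** A function whose zeros are zeros of a function with positive integral has
    itself a positive integral: otherwise both would vanish almost everywhere. *)
Lemma Rintegral_rV_gt0 f g : integrable_rV f -> integrable_rV g ->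
  (forall x, 0 <= f x) -> (forall x, 0 <= g x) ->
  (forall x, g x = 0 -> f x = 0) -> 0 < Rintegral_rV f -> 0 < Rintegral_rV g.
Proof.
move=> fi gi f0 g0 gf fI.
have E (h : 'rV[R]_n -> R) : integrable_rV h -> (forall x, 0 <= h x) ->
    ae_eq (lebesgue_tuple n) setT (fun t => (h (row_of t))%:E) (cst 0%E) <->
    Rintegral_rV h = 0.
  move=> hi h0; have mh : measurable_fun setT (fun t => (h (row_of t))%:E).
    by case/integrableP : hi.
  rewrite -(ae_eq_integral_abs _ measurableT mh).
  have -> : (\int[lebesgue_tuple n]_t `|(h (row_of t))%:E| = (Rintegral_rV h)%:E)%E.
    rewrite [RHS](EFin_Rintegral_rV hi); apply: eq_integral => t _.
    by rewrite gee0_abs// lee_fin h0.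
  by split => [[]|->].
have gI : 0 <= Rintegral_rV g by apply: Rintegral_ge0 => t _; exact: g0.
rewrite lt_neqAle gI andbT eq_sym; apply: contraTN fI => /eqP/(E _ gi g0) ae.
suff /(E _ fi f0) -> : ae_eq (lebesgue_tuple n) setT (fun t => (f (row_of t))%:E) (cst 0%E).
  by rewrite ltxx.
apply: filterS ae => t /= + _ => /(_ I) [] gt0.
by rewrite (gf _ gt0).
Qed.

Lemma is_derive_Rintegral_rV (f f' : R -> 'rV[R]_n -> R) (a e : R) (G : 'rV[R]_n -> R) :
  0 < e -> (forall s, `|s - a| < e -> integrable_rV (f s)) ->
  (forall s x, `|s - a| < e -> is_derive s 1 (f ^~ x) (f' s x)) ->
  integrable_rV G ->
  (forall s x, `|s - a| < e -> `|f' s x| <= G x) ->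
  is_derive a 1 (fun s => Rintegral_rV (f s)) (Rintegral_rV (f' a)).
Proof.
move=> e0 fi fd Gi fG.
have I s : (`](a - e), (a + e)[%classic : set R) s -> `|s - a| < e.
  by rewrite /= in_itv/= ltr_distl.
have Ia : (`](a - e), (a + e)[%classic : set R) a.
  by rewrite /= in_itv/= ltrBlDr ltrDl e0.
have D s x : `|s - a| < e -> partial1of2 (fun s t => f s (row_of t)) s x = f' s (row_of x).
  by move=> sa; rewrite partial1of2E; have [_] := fd s (row_of x) sa.
have aa : `|a - a| < e by rewrite subrr normr0.
have H := @cvg_differentiation_under_integral R _ _ (lebesgue_tuple n)
  (fun s t => f s (row_of t)) setT measurableT a _ _ Ia
  (fun s Is => fi s (I s Is)) (fun s t Is _ => let: DeriveDef d _ := fd s (row_of t) (I s Is) in d)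
  (fun t => G (row_of t)) _ Gi.
have {}H : h^-1 *: ((fun s => Rintegral_rV (f s)) (h *: 1 + a) -
    (fun s => Rintegral_rV (f s)) a) @[h --> 0^'] --> Rintegral_rV (f' a).
  under eq_fun do rewrite scaler1.
  rewrite (_ : Rintegral_rV (f' a) =
    \int[lebesgue_tuple n]_t partial1of2 (fun s t => f s (row_of t)) a t).
    apply: H => [t|s t Is _].
      by rewrite (le_trans (normr_ge0 _) (fG a _ aa)).
    by rewrite D ?fG//; exact: I.
  by apply: eq_Rintegral => t _; rewrite D.
apply: DeriveDef; first by apply/cvg_ex; exists (Rintegral_rV (f' a)).
exact/cvg_lim.
Qed.

End Rintegral.

(** * The Gaussian kernel, its derivatives and their domination *)

Section gauss_kernel.
Context {R : realType} {n : nat}.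
Implicit Types (w v : 'rV[R]_n) (s : R).
Local Notation e_ i := (delta_mx 0 i : 'rV[R]_n).

(** [gauss1 i] and [gauss2 i] are the first and second derivatives of [gauss] in
    the [i]-th coordinate, [gausst] is the derivative in the variance, and
    [gauss11 i] is [(d_i log gauss)^2 gauss], which controls the square of the
    convolution with [gauss1 i] by Cauchy-Schwarz. *)
Definition gauss1 i s w : R := - (w 0 i / s) * gauss s w.
Definition gauss2 i s w : R := (w 0 i ^+ 2 / s ^+ 2 - s^-1) * gauss s w.
Definition gausst s w : R := sqnorm w / (2 * s ^+ 2) * gauss s w.
Definition gauss11 i s w : R := (w 0 i / s) ^+ 2 * gauss s w.

Lemma gauss_gt0 s w : 0 < gauss s w.
Proof. exact: expR_gt0. Qed.

Lemma gauss_le1 s w : 0 < s -> gauss s w <= 1.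
Proof.
move=> s0; rewrite -expR0 ler_expR oppr_le0 divr_ge0 ?sqnorm_ge0//.
by rewrite mulr_ge0// ltW.
Qed.

Lemma gauss_le s s' w : 0 < s -> s <= s' -> gauss s w <= gauss s' w.
Proof.
move=> s0 ss'; rewrite ler_expR lerN2 ler_wpM2l ?sqnorm_ge0//.
by rewrite lef_pV2 ?posrE ?mulr_gt0 ?ler_wpM2l// (lt_le_trans s0).
Qed.

(** Without the factor [s^(- n / 2)] the heat equation acquires the zeroth order
    term [n / s gauss s]. *)
Lemma gausstE s w : 0 < s ->
  2 * gausst s w = \sum_i gauss2 i s w + n%:R / s * gauss s w.
Proof.
move=> s0; rewrite -mulr_suml sumrB sumr_const card_ord -mulrDl.
rewrite -mulr_suml (_ : \sum_i _ = sqnorm w); last first.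
  by apply: eq_bigr => i _; rewrite expr2.
by rewrite /gausst mulrA; congr (_ * _); rewrite -mulr_natl; field; rewrite gt_eqF.
Qed.

Lemma sqnorm_shift w i (t : R) :
  sqnorm (w + t *: e_ i) = sqnorm w + 2 * t * w 0 i + t ^+ 2.
Proof.
rewrite sqnormD dotpZr dotp_delta sqnormZ /sqnorm dotp_delta mxE !eqxx mulr1.
by rewrite mulrA.
Qed.

Lemma coord_shift w i (t : R) : (w + t *: e_ i) 0 i = w 0 i + t.
Proof. by rewrite !mxE !eqxx mulr1. Qed.

Lemma is_derive_gauss s w i (t : R) : 0 < s ->
  is_derive t 1 (fun t : R => gauss s (w + t *: e_ i)) (gauss1 i s (w + t *: e_ i)).
Proof.
move=> s0; under eq_fun do rewrite /gauss sqnorm_shift.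
apply: is_derive_eq.
rewrite /gauss1 /gauss sqnorm_shift coord_shift /GRing.scale/=.
by rewrite !(mulr1, mulr0, add0r); field; rewrite gt_eqF.
Qed.

Lemma is_derive_gauss1 s w i (t : R) : 0 < s ->
  is_derive t 1 (fun t : R => gauss1 i s (w + t *: e_ i)) (gauss2 i s (w + t *: e_ i)).
Proof.
move=> s0; have ? := is_derive_gauss w i t s0.
under eq_fun do rewrite /gauss1 coord_shift.
apply: is_derive_eq.
rewrite /gauss2 /gauss1 coord_shift /GRing.scale/=.
by rewrite !(mulr1, mulr0, add0r, addr0); field; rewrite gt_eqF.
Qed.

Lemma is_derive_gausst s w : 0 < s ->
  is_derive s 1 (fun s => gauss s w) (gausst s w).
Proof.
move=> s0; have s20 : 2 * s != 0 by rewrite mulf_neq0// gt_eqF.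
have H : is_derive s 1 (fun s : R => (2 * s)^-1) (- (2 * s) ^- 2 * 2).
  have D : is_derive s 1 (fun s : R => 2 * s) 2.
    by apply: is_derive_eq; rewrite /GRing.scale/= ?(mulr1, mulr0, add0r, addr0).
  have [dD eD] := D.
  apply: DeriveDef; first exact: derivableV.
  by rewrite deriveV// eD.
rewrite /gauss; apply: is_derive_eq.
rewrite /gausst /gauss /GRing.scale/=.
by field; rewrite gt_eqF.
Qed.

(** A polynomial factor is absorbed by enlarging the variance, since
    [q <= d^-1 e^(d q)]. *)
Lemma sqnorm_gauss_le s s' w : 0 < s -> s < s' ->
  (1 + sqnorm w) * gauss s w <= (1 + ((2 * s)^-1 - (2 * s')^-1)^-1) * gauss s' w.
Proof.
move=> s0 ss'; have s'0 := lt_trans s0 ss'.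
set d := _ - _; have d0 : 0 < d.
  by rewrite subr_gt0 ltf_pV2 ?posrE ?mulr_gt0// ltr_pM2l.
have -> : gauss s w = expR (- (sqnorm w * d)) * gauss s' w.
  rewrite -expRD; congr expR; rewrite /d; field; rewrite !gt_eqF//.
rewrite mulrA ler_wpM2r ?gauss_ge0// mulrDl mul1r.
have q0 := sqnorm_ge0 w.
rewrite lerD//; first by rewrite -expR0 ler_expR oppr_le0 mulr_ge0 ?(ltW d0).
rewrite expRN ler_pdivrMr ?expR_gt0// -ler_pdivrMl ?invr_gt0// invrK mulrC.
by rewrite (le_trans _ (expR_ge1Dx _))// lerDr.
Qed.

(** A bounded translation is absorbed in the same way: by Young's inequality
    [|w|^2 <= (1 + e) |w + v|^2 + (1 + e^-1) |v|^2], where [1 + e = s' / s]. *)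
Lemma gauss_shift_le s s' : 0 < s -> s < s' -> exists2 C, 0 < C &
  forall w v, sqnorm v <= 1 -> gauss s (w + v) <= C * gauss s' w.
Proof.
move=> s0 ss'; have s'0 := lt_trans s0 ss'.
pose e := s' / s - 1; have e0 : 0 < e by rewrite subr_gt0 ltr_pdivlMr// mul1r.
exists (expR ((1 + e^-1) / (2 * s'))); first exact: expR_gt0.
move=> w v v1; rewrite -expRD ler_expR lerNl opprB -mulrBl.
set a := w + v; have -> : w = a - v by rewrite /a addrK.
rewrite sqnormB.
have H : 0 <= e^-1 * sqnorm (e *: a + v) by rewrite mulr_ge0 ?sqnorm_ge0 ?invr_ge0 ?(ltW e0).
have {}H : - (2 * dotp a v) <= e * sqnorm a + e^-1 * sqnorm v.
  move: H; rewrite sqnormD sqnormZ dotpZl !mulrDr expr2 !mulrA mulVf ?gt_eqF// mul1r.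
  rewrite (_ : e^-1 * 2 * e = 2); last by field; rewrite gt_eqF.
  by move=> H; rewrite -subr_ge0; apply: (le_trans H); lra.
have -> : sqnorm a / (2 * s) = (s' / s * sqnorm a) / (2 * s') by field; rewrite !gt_eqF.
rewrite ler_pM2r ?invr_gt0 ?mulr_gt0//.
have : (1 + e^-1) * sqnorm v <= 1 + e^-1.
  by rewrite ler_piMr// addr_ge0// invr_ge0 ltW.
have -> : s' / s = e + 1 by rewrite subrK.
lra.
Qed.

End gauss_kernel.

(** * Convolutions with an initial density *)

Section kernels.
Context {R : realType} {n : nat}.
Implicit Types (k : 'rV[R]_n -> R) (w v x : 'rV[R]_n).
Local Notation e_ i := (delta_mx 0 i : 'rV[R]_n).

Definition bounded_kernel k :=
  measurable_rV k /\ exists C, forall w, `|k w| <= C.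

Lemma bounded_kernel_shift k v : bounded_kernel k -> bounded_kernel (fun w => k (w + v)).
Proof.
move=> [mk [C kC]]; split; last by exists C => w; exact: kC.
exact: measurable_rV_shift.
Qed.

Lemma bounded_kernelD k1 k2 : bounded_kernel k1 -> bounded_kernel k2 ->
  bounded_kernel (fun w => k1 w + k2 w).
Proof.
move=> [m1 [C1 k1C]] [m2 [C2 k2C]]; split; first exact: measurable_funD.
by exists (C1 + C2) => w; rewrite (le_trans (ler_normD _ _))// lerD.
Qed.

Lemma bounded_kernelZ (c : R) k : bounded_kernel k ->
  bounded_kernel (fun w => c * k w).
Proof.
move=> [mk [C kC]]; split; first exact: measurable_funM.
by exists (`|c| * C) => w; rewrite normrM ler_wpM2l.
Qed.

Lemma bounded_kernel_cst (c : R) : bounded_kernel (fun=> c).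
Proof. by split; [exact: measurable_cst|exists `|c|]. Qed.

Lemma bounded_kernel_sum m (K : 'I_m -> 'rV[R]_n -> R) :
  (forall i, bounded_kernel (K i)) -> bounded_kernel (fun w => \sum_i K i w).
Proof.
move=> bK; split; first by apply: measurable_sum => i; case: (bK i).
have /choice[C HC] : forall i, exists C, forall w, `|K i w| <= C.
  by move=> i; case: (bK i).
exists (\sum_i C i) => w; rewrite (le_trans (ler_norm_sum _ _ _))//.
by apply: ler_sum => i _; exact: HC.
Qed.

Lemma bounded_gauss s : 0 < s -> bounded_kernel (gauss s).
Proof.
move=> s0; split; first exact: measurable_gauss.
by exists 1 => w; rewrite ger0_norm ?gauss_ge0 ?gauss_le1.
Qed.

Lemma le_bounded_kernel k s C : 0 < s -> measurable_rV k ->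
  (forall w, `|k w| <= C * gauss s w) -> bounded_kernel k.
Proof.
move=> s0 mk kC; split => //; exists `|C| => w.
rewrite (le_trans (kC w))// (le_trans (ler_norm _))// normrM.
by rewrite ler_piMr// ger0_norm ?gauss_ge0 ?gauss_le1.
Qed.

Lemma measurable_gauss1 i s : measurable_rV (@gauss1 R n i s).
Proof.
apply: measurable_funM; last exact: measurable_gauss.
by apply: measurableT_comp => //; apply: measurable_funM => //; exact: measurable_coord.
Qed.

Lemma measurable_gauss2 i s : measurable_rV (@gauss2 R n i s).
Proof.
apply: measurable_funM; last exact: measurable_gauss.
apply: measurable_funB => //; apply: measurable_funM => //.
by apply: measurable_funX; exact: measurable_coord.
Qed.

Lemma measurable_gausst s : measurable_rV (@gausst R n s).
Proof.
apply: measurable_funM; last exact: measurable_gauss.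
by apply: measurable_funM => //; exact: measurable_sqnorm.
Qed.

Lemma measurable_gauss11 i s : measurable_rV (@gauss11 R n i s).
Proof.
apply: measurable_funM; last exact: measurable_gauss.
by apply: measurable_funX; apply: measurable_funM => //; exact: measurable_coord.
Qed.

(** Every kernel met below is a quadratic polynomial times a Gaussian, so a
    slightly wider Gaussian dominates it, uniformly for variances in a compact
    range and for translations of length at most one. *)
Lemma gauss_dominated (s0 s1 s2 : R) : 0 < s0 -> s0 <= s1 -> s1 < s2 ->
  exists2 C : R, 0 < C & forall (s : R) w v, s0 <= s <= s1 -> sqnorm v <= 1 ->
  [/\ gauss s (w + v) <= C * gauss s2 w,
      `|gausst s (w + v)| <= C * gauss s2 w &
      forall i, [/\ `|gauss1 i s (w + v)| <= C * gauss s2 w,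
                 `|gauss2 i s (w + v)| <= C * gauss s2 w &
                 `|gauss11 i s (w + v)| <= C * gauss s2 w]].
Proof.
move=> s00 s01 s12; pose sm := (s1 + s2) / 2.
have s10 : 0 < s1 by exact: lt_le_trans s01.
have s1m : s1 < sm by rewrite /sm; lra.
have sm2 : sm < s2 by rewrite /sm; lra.
have sm0 : 0 < sm by exact: lt_trans s1m.
have [C C0 HC] := @gauss_shift_le R n _ _ (lt_trans s10 s1m) sm2.
pose D := 1 + ((2 * s1)^-1 - (2 * sm)^-1)^-1.
have D0 : 0 < D.
  have H : 2 * s1 < 2 * sm by rewrite ltr_pM2l.
  by rewrite addr_gt0// invr_gt0 subr_gt0 ltf_pV2// posrE mulr_gt0.
pose K := (1 + s0^-1) ^+ 2.
have K0 : 0 < K by rewrite exprn_gt0// addr_gt0// invr_gt0.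
have si0 : 0 < s0^-1 by rewrite invr_gt0.
have K1 : 1 <= K by rewrite /K; nra.
have K2 : s0^-1 <= K by rewrite /K; nra.
have K3 : s0^-1 ^+ 2 <= K by rewrite /K; nra.
exists (K * D * C) => [|s w v /andP[s0s ss1] v1]; first exact: mulr_gt0 (mulr_gt0 K0 D0) C0.
have sp : 0 < s by exact: lt_le_trans s0s.
have sV : s^-1 <= s0^-1 by rewrite lef_pV2 ?posrE.
have sV0 : 0 < s^-1 by rewrite invr_gt0.
have sV2 : s^-1 ^+ 2 <= K.
  by apply: (le_trans _ K3); rewrite !expr2; apply: ler_pM => //; exact: ltW.
set u := w + v; have qu := sqnorm_ge0 u.
have H a : `|a| <= K * (1 + sqnorm u) -> `|a * gauss s u| <= K * D * C * gauss s2 w.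
  move=> aK; rewrite normrM (ger0_norm (gauss_ge0 _ _)).
  rewrite (@le_trans _ _ (K * ((1 + sqnorm u) * gauss s1 u)))//.
    rewrite mulrA ler_pM ?gauss_ge0 ?gauss_le//.
  rewrite -2!mulrA; apply: ler_wpM2l; first exact: ltW.
  apply: (le_trans (sqnorm_gauss_le u s10 s1m)); rewrite -/D.
  by apply: ler_wpM2l; [exact: ltW|exact: HC].
split.
- by rewrite -[leLHS]ger0_norm ?gauss_ge0// -[gauss s u]mul1r H// normr1; nra.
- apply: H; rewrite ger0_norm ?divr_ge0 ?mulr_ge0 ?exprn_ge0 ?(ltW sp)//.
  rewrite invfM -exprVn mulrA mulrC ler_pM ?exprn_ge0 ?divr_ge0 ?(ltW sV0)//.
  by lra.
- move=> i; have ui := coord_sqr_le u i; have ui0 : 0 <= u 0 i ^+ 2 := sqr_ge0 _.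
  split; apply: H.
  + rewrite normrN normrM (ger0_norm (ltW sV0)) mulrC ler_pM ?(ltW sV0)//.
      exact: le_trans K2.
    rewrite ler_norml; apply/andP; split; nra.
  + have A : `|u 0 i ^+ 2 / s ^+ 2| <= K * sqnorm u.
      rewrite -exprVn ger0_norm ?(mulr_ge0 ui0 (sqr_ge0 _))// mulrC.
      by apply: ler_pM; rewrite ?sqr_ge0.
    have B : `|s^-1| <= K by rewrite ger0_norm ?(ltW sV0)// (le_trans sV).
    by apply: (le_trans (ler_normB _ _)); lra.
  + rewrite exprMn ger0_norm ?(mulr_ge0 ui0 (sqr_ge0 _))// mulrC.
    by apply: ler_pM; rewrite ?sqr_ge0//; lra.
Qed.

End kernels.

Section convolution.
Context {R : realType} {n : nat} (psi : 'rV[R]_n -> R).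
Hypothesis psi_ge0 : forall x, 0 <= psi x.
Hypothesis psi_int : integrable_rV psi.
Implicit Types (k : 'rV[R]_n -> R) (w v x : 'rV[R]_n).
Local Notation e_ i := (delta_mx 0 i : 'rV[R]_n).

Definition convolve k x : R := Rintegral_rV (fun z => k (x - z) * psi z).

Lemma measurable_subl k x : measurable_rV k -> measurable_rV (fun z => k (x - z)).
Proof.
move=> mk; apply: (measurable_rV_comp mk) => i.
under eq_fun do rewrite !mxE.
by apply: measurable_funB => //; exact: measurable_tnth.
Qed.

Lemma convolve_integrable k x : bounded_kernel k ->
  integrable_rV (fun z => k (x - z) * psi z).
Proof.
move=> [mk [C kC]]; apply: (@le_integrable_rV _ _ _ (fun z => C * psi z)).
- apply: measurable_funM; last exact: integrable_rV_measurable.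
  exact: measurable_subl.
- exact: integrable_rVZl.
- by move=> z; rewrite normrM (ger0_norm (psi_ge0 z)) ler_wpM2r.
Qed.

(** Translations act on the kernel alone, so that derivatives of a convolution
    in its variable are derivatives in a parameter of the kernel. *)
Lemma convolve_shift k x v : convolve k (x + v) = convolve (fun w => k (w + v)) x.
Proof. by apply: eq_Rintegral_rV => z; rewrite addrAC. Qed.

Lemma convolveD k1 k2 x : bounded_kernel k1 -> bounded_kernel k2 ->
  convolve (fun w => k1 w + k2 w) x = convolve k1 x + convolve k2 x.
Proof.
move=> b1 b2; rewrite /convolve -Rintegral_rVD; try exact: convolve_integrable.
by apply: eq_Rintegral_rV => z; rewrite mulrDl.
Qed.

Lemma convolveZ c k x : bounded_kernel k -> convolve (fun w => c * k w) x = c * convolve k x.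
Proof.
move=> b; rewrite /convolve -Rintegral_rVZl; last exact: convolve_integrable.
by apply: eq_Rintegral_rV => z; rewrite mulrA.
Qed.

Lemma convolve_sum (I : finType) (K : I -> 'rV[R]_n -> R) x :
  (forall i, bounded_kernel (K i)) ->
  convolve (fun w => \sum_i K i w) x = \sum_i convolve (K i) x.
Proof.
move=> bK; rewrite /convolve -Rintegral_rV_sum => [|i]; last exact: convolve_integrable.
by apply: eq_Rintegral_rV => z; rewrite mulr_suml.
Qed.

Lemma le_convolve k1 k2 x : bounded_kernel k1 -> bounded_kernel k2 ->
  (forall w, k1 w <= k2 w) -> convolve k1 x <= convolve k2 x.
Proof.
move=> b1 b2 k12; apply: le_Rintegral_rV; try exact: convolve_integrable.
by move=> z; rewrite ler_wpM2r.
Qed.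

Lemma norm_convolve k1 k2 x : bounded_kernel k1 -> bounded_kernel k2 ->
  (forall w, `|k1 w| <= k2 w) -> `|convolve k1 x| <= convolve k2 x.
Proof.
move=> [m1 _] b2 k12; apply: norm_Rintegral_rV.
- apply: measurable_funM; last exact: integrable_rV_measurable.
  exact: measurable_subl.
- exact: convolve_integrable.
- by move=> z; rewrite normrM (ger0_norm (psi_ge0 z)) ler_wpM2r.
Qed.

Lemma measurable_convolve2 k : measurable_rV k ->
  measurable_fun setT (fun z : n.-tuple (measurableTypeR R) * n.-tuple (measurableTypeR R) =>
     k (row_of z.1 - row_of z.2)).
Proof.
move=> mk; apply: (measurable_rV_comp mk) => i.
under eq_fun do rewrite !mxE.
by apply: measurable_funB; apply: (measurableT_comp (measurable_tnth i)).
Qed.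

Lemma ge0_measurable_convolve k : bounded_kernel k -> (forall w, 0 <= k w) ->
  measurable_rV (convolve k).
Proof.
move=> bk k0.
pose F x := integral_rV (fun z => (k (x - z) * psi z)%:E).
have mF : measurable_rV F.
  apply: measurable_tonelli_rV; last by move=> x z; rewrite lee_fin mulr_ge0.
  apply/measurable_EFinP; apply: measurable_funM.
    by apply: measurable_convolve2; case: bk.
  exact: (measurableT_comp (integrable_rV_measurable psi_int)).
have mfF : measurable_fun setT (fine \o (F \o row_of)) by exact: measurableT_comp.
exact: mfF.
Qed.

(** A constant makes the bounded kernel nonnegative, where Tonelli's theorem
    applies. *)
Lemma measurable_convolve k : bounded_kernel k -> measurable_rV (convolve k).
Proof.
move=> bk; have [mk [C kC]] := bk.
have bC := @bounded_kernel_cst R n.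
rewrite (_ : convolve k = fun x => convolve (fun w => k w + C) x - convolve (fun=> C) x).
  apply: measurable_funB; apply: ge0_measurable_convolve => //.
  - exact: bounded_kernelD.
  - by move=> w; have := kC w; rewrite ler_norml => /andP[+ _]; rewrite -subr_ge0 opprK.
  - by move=> w; rewrite (le_trans _ (kC w)).
by apply/funext => x; rewrite convolveD// addrK.
Qed.

Lemma convolve_gt0 k x : 0 < Rintegral_rV psi -> bounded_kernel k ->
  (forall w, 0 < k w) -> 0 < convolve k x.
Proof.
move=> p0 bk k0; apply: (Rintegral_rV_gt0 psi_int (convolve_integrable x bk)) => //.
- by move=> z; rewrite mulr_ge0// ltW.
- by move=> z /eqP; rewrite mulf_eq0 gt_eqF//= => /eqP.
Qed.

Lemma convolve_is_derive (K K' : R -> 'rV[R]_n -> R) (a e C : R) x : 0 < e ->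
  (forall s, `|s - a| < e -> bounded_kernel (K s)) ->
  (forall s w, `|s - a| < e -> is_derive s 1 (K ^~ w) (K' s w)) ->
  (forall s w, `|s - a| < e -> `|K' s w| <= C) ->
  is_derive a 1 (fun s => convolve (K s) x) (convolve (K' a) x).
Proof.
move=> e0 bK dK K'C.
apply: (@is_derive_Rintegral_rV _ _ _ (fun s z => K' s (x - z) * psi z) a e
  (fun z => C * psi z)) => //.
- by move=> s sa; apply: convolve_integrable; exact: bK.
- move=> s z sa; have ? := dK s (x - z) sa.
  by apply: is_derive_eq; rewrite /GRing.scale/= mulr0 add0r mulrC.
- exact: integrable_rVZl.
- by move=> s z sa; rewrite normrM (ger0_norm (psi_ge0 z)) ler_wpM2r ?K'C.
Qed.

End convolution.

(** * The heat semigroup and the domain of the tilted integral *)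

Section semigroup.
Context {R : realType} {n : nat} (psi : 'rV[R]_n -> R).
Hypothesis psi_ge0 : forall x, 0 <= psi x.
Hypothesis psi_int : integrable_rV psi.
Hypothesis psi_gt0 : 0 < Rintegral_rV psi.
Implicit Types (w v x b : 'rV[R]_n) (s t q : R).
Local Notation mR := (measurableTypeR R).

Definition heat s x : R := convolve psi (gauss s) x.

Lemma heat_gt0 s x : 0 < s -> 0 < heat s x.
Proof. by move=> s0; apply: convolve_gt0 => //; [exact: bounded_gauss|exact: gauss_gt0]. Qed.

Lemma measurable_heat s : 0 < s -> measurable_rV (heat s).
Proof. by move=> s0; apply: measurable_convolve => //; exact: bounded_gauss. Qed.

Lemma heat_le s s' x : 0 < s -> s <= s' -> heat s x <= heat s' x.
Proof.
move=> s0 ss'; apply: le_convolve => //; try exact: bounded_gauss.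
  by apply: bounded_gauss; exact: lt_le_trans ss'.
by move=> w; exact: gauss_le.
Qed.

(** Completing the square in [w]: the product of two Gaussians centred at [x] and
    [z] is a Gaussian in [w] times the Gaussian of [x - z] whose variance is the
    sum. *)
Lemma gauss_mul s t x w z : 0 < s -> 0 < t ->
  gauss t (x - w) * gauss s (w - z) =
  gauss (s + t) (x - z) *
  gauss (s * t / (s + t)) (w - (z + (s / (s + t)) *: (x - z))).
Proof.
move=> s0 t0; have st0 : s + t != 0 by rewrite gt_eqF// addr_gt0.
rewrite -!expRD; congr expR.
rewrite (_ : x - w = (x - z) - (w - z)); last first.
  by rewrite opprB addrA subrK.
rewrite [in RHS](_ : w - _ = (w - z) - (s / (s + t)) *: (x - z)); last first.
  by rewrite opprD addrA.
move: (x - z) (w - z) => a b.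
rewrite !(sqnormB, sqnormZ, dotpZr) (dotpC b).
by field; rewrite st0 !gt_eqF// !mulr_gt0.
Qed.

(** Completing the square: an exponential tilt translates a Gaussian. *)
Lemma gauss_expdot t x w b : 0 < t ->
  expR (dotp x b) * gauss t (x - w) =
  expR (dotp w b + t * sqnorm b / 2) * gauss t (x - (w + t *: b)).
Proof.
move=> t0; rewrite -!expRD; congr expR.
rewrite opprD addrA -[in dotp x b](subrK w x); move: (x - w) => a.
rewrite !(sqnormB, sqnormZ, dotpZr, dotpDl).
by field; rewrite gt_eqF.
Qed.

Lemma heat_semigroup s t x : 0 < s -> 0 < t ->
  integral_rV (fun w => (gauss t (x - w) * heat s w)%:E) =
  (Num.sqrt (2 * pi * (s * t / (s + t))) ^+ n * heat (s + t) x)%:E.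
Proof.
move=> s0 t0; have st0 : 0 < s + t by rewrite addr_gt0.
have mpsi := integrable_rV_measurable psi_int.
have mg s' := @measurable_gauss R n s'.
transitivity (integral_rV (fun w => integral_rV (fun z =>
    (gauss t (x - w) * gauss s (w - z) * psi z)%:E))).
  apply: eq_integral => u _; rewrite EFinM EFin_Rintegral_rV; last first.
    by apply: convolve_integrable => //; exact: bounded_gauss.
  rewrite -ge0_integralZl_EFin//.
  - by apply: eq_integral => z _; rewrite -EFinM mulrA.
  - by move=> z _; rewrite lee_fin mulr_ge0// gauss_ge0.
  - apply/measurable_EFinP; apply: measurable_funM => //.
    exact: (measurable_subl _ (mg s)).
  - exact: gauss_ge0.
rewrite tonelli_rV; last 2 first.
- apply/measurable_EFinP; apply: measurable_funM; last first.
    exact: (measurableT_comp mpsi).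
  apply: measurable_funM; last exact: measurable_convolve2.
  exact: (measurableT_comp (measurable_subl x (mg t))).
- by move=> w z; rewrite lee_fin !mulr_ge0// gauss_ge0.
rewrite EFinM EFin_Rintegral_rV; last first.
  by apply: convolve_integrable => //; exact: bounded_gauss.
rewrite -ge0_integralZl_EFin//; last 2 first.
- by move=> z _; rewrite lee_fin mulr_ge0// gauss_ge0.
- apply/measurable_EFinP; apply: measurable_funM => //.
  exact: (measurable_subl _ (mg (s + t))).
apply: eq_integral => z _; set z' := row_of z.
rewrite -[X in (X * _)%E](integral_gauss (z' + (s / (s + t)) *: (x - z'))); last first.
  by rewrite divr_gt0// mulr_gt0.
rewrite [RHS]muleC -ge0_integralZl_EFin//.
- apply: eq_integral => w _.
  by rewrite gauss_mul// -EFinM; congr (_%:E); rewrite -!mulrA; congr (_ * _); rewrite mulrC.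
- by move=> w _; rewrite lee_fin gauss_ge0.
- by apply/measurable_EFinP; exact: measurable_rV_shift (mg _).
- by rewrite mulr_ge0// gauss_ge0.
Qed.

(** Convexity in tangent-line form: with the average of [a] as tangent point
    [c], integrating it gives Jensen's inequality. *)
Lemma powR_tangent (q a c : R) : 1 < q -> 0 <= a -> 0 < c ->
  q * c `^ (q - 1) * a <= a `^ q + (q - 1) * c `^ q.
Proof.
move=> q1 a0 c0; have q0 : 0 < q by exact: lt_trans q1.
have q10 : 0 < q - 1 by rewrite subr_gt0.
have := @conjugate_powR R a (c `^ (q - 1)) q (q / (q - 1)) a0 (powR_ge0 _ _) q0 (divr_gt0 q0 q10).
rewrite -powRrM (_ : (q - 1) * (q / (q - 1)) = q); last by field; rewrite gt_eqF.
have E : q^-1 + (q / (q - 1))^-1 = 1 by field; rewrite !gt_eqF.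
move=> /(_ E) H; have := ler_wpM2l (ltW q0) H.
have -> : q * c `^ (q - 1) * a = q * (a * c `^ (q - 1)) by ring.
move=> {}H; apply: (le_trans H); rewrite le_eqVlt; apply/orP; left; apply/eqP.
by field; rewrite !gt_eqF.
Qed.

Definition laplace q s b : \bar R :=
  integral_rV (fun x => (expR (dotp x b) * heat s x `^ q)%:E).

Lemma measurable_laplace q s b : 0 < s ->
  measurable_rV (fun x => expR (dotp x b) * heat s x `^ q).
Proof.
move=> s0; apply: measurable_funM.
  exact: (measurableT_comp (@measurable_expR R) (measurable_dotp b)).
exact: (measurableT_comp (measurable_powR q) (measurable_heat s0)).
Qed.

(** Up to a constant, [heat (s + t)] is the average of [heat s] against the
    Gaussian [K] of variance [t].  Jensen's inequality moves the power [q]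
    inside the average, and in the remaining double integral the average of
    [e^<x, b>] under [K] is [e^<w, b>] times a constant. *)
Lemma laplace_add_lty q s t b : 1 < q -> 0 < s -> 0 < t ->
  (laplace q s b < +oo)%E -> (laplace q (s + t) b < +oo)%E.
Proof.
move=> q1 s0 t0 Hfin; have st0 : 0 < s + t by rewrite addr_gt0.
have q0 : 0 < q by exact: lt_trans q1.
have mg s' := @measurable_gauss R n s'.
have mh := measurable_heat s0.
pose Z := Num.sqrt (2 * pi * t) ^+ n.
have Z0 : 0 < Z by rewrite exprn_gt0// sqrtr_gt0 !mulr_gt0// pi_gt0.
pose c := Num.sqrt (2 * pi * (s * t / (s + t))) ^+ n / Z.
have c0 : 0 < c.
  by rewrite divr_gt0// exprn_gt0// sqrtr_gt0 !mulr_gt0 ?pi_gt0 ?invr_gt0// mulr_gt0.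
pose K (x w : 'rV[R]_n) := Z^-1 * gauss t (x - w).
have K0 x w : 0 <= K x w by rewrite mulr_ge0 ?gauss_ge0// invr_ge0 ltW.
have mK x : measurable_rV (K x).
  by apply: measurable_funM => //; exact: (measurable_subl _ (mg t)).
pose A x := c * heat (s + t) x.
have A0 x : 0 < A x by rewrite mulr_gt0// heat_gt0.
have K1 x : integral_rV (fun w => (K x w)%:E) = 1%E.
  rewrite ge0_integral_rVZl ?invr_ge0 ?(ltW Z0)//; last 2 first.
  - exact: (measurable_subl _ (mg t)).
  - by move=> w; exact: gauss_ge0.
  rewrite (_ : integral_rV _ = Z%:E) -?EFinM ?mulVf ?gt_eqF//.
  rewrite -(integral_gauss x t0); apply: eq_integral_rV => w.
  by rewrite /gauss -sqnormN opprB.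
have KA x : integral_rV (fun w => (K x w * heat s w)%:E) = (A x)%:E.
  under eq_integral_rV do rewrite -mulrA.
  rewrite ge0_integral_rVZl ?invr_ge0 ?(ltW Z0)//; last 2 first.
  - by apply: measurable_funM => //; exact: (measurable_subl _ (mg t)).
  - by move=> w; rewrite mulr_ge0 ?gauss_ge0// ltW// heat_gt0.
  rewrite heat_semigroup// -EFinM; congr EFin.
  by rewrite /A /c; ring.
have mhq : measurable_rV (fun w => heat s w `^ q).
  exact: (measurableT_comp (measurable_powR q)).
have mKh x : measurable_rV (fun w => K x w * heat s w).
  exact: (measurable_funM (mK x) mh).
have mKhq x : measurable_rV (fun w => K x w * heat s w `^ q).
  exact: (measurable_funM (mK x) mhq).
have mKc x a : measurable_rV (fun w => a * K x w).
  by apply: measurable_funM => //; exact: mK.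
(* the tangent line is taken at [A x], the average of [heat s] under [K x] *)
have J x : ((A x `^ q)%:E <= integral_rV (fun w => (K x w * heat s w `^ q)%:E))%E.
  set J := integral_rV _.
  have hq w : 0 <= heat s w by rewrite ltW// heat_gt0.
  have q1A : 0 <= (q - 1) * A x `^ q by rewrite mulr_ge0 ?powR_ge0// subr_ge0 ltW.
  have qA : 0 <= q * A x `^ (q - 1) by rewrite mulr_ge0 ?powR_ge0// ltW.
  have HJ : (integral_rV (fun w => ((q * A x `^ (q - 1)) * (K x w * heat s w))%:E) <=
    integral_rV (fun w => (K x w * heat s w `^ q + (q - 1) * A x `^ q * K x w)%:E))%E.
    apply: ge0_le_integral_rV.
    - by apply: measurable_funM => //; exact: mKh.
    - by apply: measurable_funD; [exact: mKhq|exact: mKc].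
    - by move=> w; rewrite (mulr_ge0 qA)// mulr_ge0.
    - move=> w; have := powR_tangent q1 (hq w) (A0 x).
      by move=> /(ler_wpM2l (K0 x w)); lra.
  move: HJ; rewrite ge0_integral_rVZl//; last first.
    by move=> w; rewrite mulr_ge0.
  rewrite KA ge0_integral_rVD//; last 2 first.
  - by move=> w; rewrite mulr_ge0// powR_ge0.
  - by move=> w; rewrite mulr_ge0.
  rewrite ge0_integral_rVZl// K1 mule1 -/J -EFinM.
  have -> : q * A x `^ (q - 1) * A x = A x `^ q + (q - 1) * A x `^ q.
    by rewrite -mulrA (mulrC _ (A x)) mulr_powRB1 ?(ltW (A0 x))//; ring.
  by rewrite EFinD leeD2rE.
(* [B] is the moment generating function of the Gaussian of variance [t] *)
pose B := expR (t * sqnorm b / 2).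
have Kexp w : integral_rV (fun x => (expR (dotp x b) * K x w)%:E) = (B * expR (dotp w b))%:E.
  have E x : expR (dotp x b) * K x w =
     (Z^-1 * expR (dotp w b) * B) * gauss t (x - (w + t *: b)).
    by rewrite /K mulrCA gauss_expdot// expRD -/B !mulrA.
  under eq_integral_rV do rewrite E.
  rewrite ge0_integral_rVZl; last 3 first.
  - by rewrite !mulr_ge0 ?expR_ge0// invr_ge0 ltW.
  - exact: measurable_rV_shift (mg t).
  - by move=> x; exact: gauss_ge0.
  rewrite integral_gauss// -EFinM; congr EFin.
  by rewrite -/Z; field; rewrite gt_eqF.
have mexp : measurable_rV (fun x => expR (dotp x b)).
  exact: (measurableT_comp (@measurable_expR R) (measurable_dotp b)).
pose G (x w : 'rV[R]_n) := expR (dotp x b) * (K x w * heat s w `^ q).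
have G0 x w : (0 <= (G x w)%:E)%E.
  by rewrite lee_fin mulr_ge0 ?expR_ge0// mulr_ge0 ?powR_ge0.
have mG : measurable_fun setT (fun z : n.-tuple mR * n.-tuple mR =>
    (G (row_of z.1) (row_of z.2))%:E).
  apply/measurable_EFinP; apply: measurable_funM.
    exact: (measurableT_comp mexp).
  apply: measurable_funM; last exact: (measurableT_comp mhq).
  by apply: measurable_funM => //; exact: (measurable_convolve2 (mg t)).
have main : ((c `^ q)%:E * laplace q (s + t) b <= B%:E * laplace q s b)%E.
  rewrite /laplace -[leLHS]ge0_integral_rVZl ?powR_ge0//; last 2 first.
  - exact: measurable_laplace.
  - by move=> x; rewrite mulr_ge0 ?expR_ge0 ?powR_ge0.
  apply: (@le_trans _ _ (integral_rV (fun x => integral_rV (fun w => (G x w)%:E)))).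
    apply: ge0_le_integral => //.
    - by move=> x _; rewrite lee_fin !mulr_ge0 ?expR_ge0 ?powR_ge0.
    - apply/measurable_EFinP; apply: measurable_funM => //.
      exact: measurable_laplace.
    - exact: (@measurable_tonelli_rV R n n (fun x w => (G x w)%:E) mG G0).
    - move=> x _; set x' := row_of x.
      have -> : c `^ q * (expR (dotp x' b) * heat (s + t) x' `^ q) =
          expR (dotp x' b) * A x' `^ q.
        have hx := ltW (heat_gt0 x' st0).
        by rewrite /A (powRM _ (ltW c0) hx); ring.
      rewrite [leRHS]ge0_integral_rVZl ?expR_ge0//; last first.
        by move=> w; rewrite mulr_ge0// powR_ge0.
      by rewrite EFinM lee_wpmul2l// lee_fin expR_ge0.
  rewrite tonelli_rV//.
  rewrite -[leRHS]ge0_integral_rVZl ?expR_ge0//; last 2 first.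
  - exact: measurable_laplace.
  - by move=> x; rewrite mulr_ge0 ?expR_ge0 ?powR_ge0.
  rewrite le_eqVlt; apply/orP; left; apply/eqP.
  apply: eq_integral_rV => w.
  transitivity ((heat s w `^ q)%:E * integral_rV (fun x => (expR (dotp x b) * K x w)%:E))%E.
    rewrite -ge0_integral_rVZl ?powR_ge0//.
    - by apply: eq_integral_rV => x; rewrite /G; congr EFin; ring.
    - apply: measurable_funM => //; apply: measurable_funM => //.
      exact: measurable_rV_shift (mg t).
    - by move=> x; rewrite mulr_ge0 ?expR_ge0.
  by rewrite Kexp -EFinM; congr EFin; ring.
have {}main : ((c `^ q)%:E * laplace q (s + t) b < +oo)%E.
  by apply: (le_lt_trans main); rewrite lte_mul_pinfty// lee_fin expR_ge0.
rewrite ltey; apply/eqP => E; move: main.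
by rewrite E gt0_muley// lte_fin powR_gt0.
Qed.

End semigroup.

(** * Derivatives of the heat flow *)

Section heat_derivatives.
Context {R : realType} {n : nat} (psi : 'rV[R]_n -> R).
Hypothesis psi_ge0 : forall x, 0 <= psi x.
Hypothesis psi_int : integrable_rV psi.
Hypothesis psi_gt0 : 0 < Rintegral_rV psi.
Implicit Types (w v x b : 'rV[R]_n) (s t q : R).
Local Notation heat := (heat psi).
Local Notation e_ i := (delta_mx 0 i : 'rV[R]_n).

Definition heat1 i s x : R := convolve psi (gauss1 i s) x.
Definition heat2 i s x : R := convolve psi (gauss2 i s) x.
Definition heatt s x : R := convolve psi (gausst s) x.
Definition heat11 i s x : R := convolve psi (gauss11 i s) x.

Lemma bounded_gauss_kernels s : 0 < s ->
  [/\ bounded_kernel (@gausst R n s) & forall i, [/\ bounded_kernel (@gauss1 R n i s),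
   bounded_kernel (@gauss2 R n i s) & bounded_kernel (@gauss11 R n i s)]].
Proof.
move=> s0; have ss : s < s + 1 by rewrite ltrDl.
have [C C0 HC] := @gauss_dominated R n s s (s + 1) s0 (lexx _) ss.
have v0 : sqnorm (0 : 'rV[R]_n) <= 1 by rewrite /sqnorm dotp0l.
have {}HC w := HC s w 0 _ v0.
have sss : s <= s <= s by rewrite lexx.
have s10 : 0 < s + 1 by rewrite addr_gt0.
split=> [|i].
  apply: (le_bounded_kernel (C := C) s10 (@measurable_gausst R n s)) => w.
  by have [_ + _] := HC sss w; rewrite addr0.
split.
- apply: (le_bounded_kernel (C := C) s10 (@measurable_gauss1 R n i s)) => w.
  by have [_ _ /(_ i)[]] := HC sss w; rewrite addr0.
- apply: (le_bounded_kernel (C := C) s10 (@measurable_gauss2 R n i s)) => w.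
  by have [_ _ /(_ i)[]] := HC sss w; rewrite addr0.
- apply: (le_bounded_kernel (C := C) s10 (@measurable_gauss11 R n i s)) => w.
  by have [_ _ /(_ i)[]] := HC sss w; rewrite addr0.
Qed.

Lemma heat_dominated (s0 s1 s2 : R) : 0 < s0 -> s0 <= s1 -> s1 < s2 ->
  exists2 C : R, 0 < C & forall (s : R) x v, s0 <= s <= s1 -> sqnorm v <= 1 ->
  [/\ heat s (x + v) <= C * heat s2 x,
      `|heatt s (x + v)| <= C * heat s2 x &
      forall i, [/\ `|heat1 i s (x + v)| <= C * heat s2 x,
                 `|heat2 i s (x + v)| <= C * heat s2 x &
                 heat11 i s (x + v) <= C * heat s2 x]].
Proof.
move=> s00 s01 s12; have [C C0 HC] := @gauss_dominated R n s0 s1 s2 s00 s01 s12.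
exists C => // s x v ss v1.
have sp : 0 < s by case/andP : ss => + _; exact: lt_le_trans.
have s20 : 0 < s2 by rewrite (lt_trans _ s12)// (lt_le_trans s00).
have [bt bi] := bounded_gauss_kernels sp.
have bC : bounded_kernel (fun w => C * @gauss R n s2 w).
  by apply: bounded_kernelZ; exact: bounded_gauss.
have bg := @bounded_gauss R n s sp.
have main k : bounded_kernel k -> (forall w, `|k (w + v)| <= C * gauss s2 w) ->
    `|convolve psi k (x + v)| <= C * heat s2 x.
  move=> bk kC; rewrite convolve_shift /(heat _ _) -convolveZ//; last exact: bounded_gauss.
  by apply: norm_convolve => //; exact: bounded_kernel_shift.
have {}HC w := HC s w v ss v1.
split.
- rewrite (le_trans (ler_norm _))// main// => w.
  by have [+ _ _] := HC w; rewrite ger0_norm ?gauss_ge0.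
- by apply: main => // w; have [_ + _] := HC w.
- move=> i; have [b1 b2 b11] := bi i; split.
  + by apply: main => // w; have [_ _ /(_ i)[]] := HC w.
  + by apply: main => // w; have [_ _ /(_ i)[]] := HC w.
  + rewrite (le_trans (ler_norm _))//.
    by apply: main => // w; have [_ _ /(_ i)[]] := HC w.
Qed.

(** Cauchy-Schwarz inequality for the measure [gauss s (x - z) psi z dz]: the
    integral of [(w_i / s + l)^2] against it is nonnegative, and [l] minimises
    it.  This is what bounds [tilt11], which is quadratic in [heat1]. *)
Lemma heat1_sqr_le i s x : 0 < s -> heat1 i s x ^+ 2 <= heat s x * heat11 i s x.
Proof.
move=> s0; have [_ /(_ i)[b1 _ b11]] := bounded_gauss_kernels s0.
have bg := @bounded_gauss R n s s0.
have h0 : 0 < heat s x by exact: heat_gt0.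
pose l := heat1 i s x / heat s x.
have H : 0 <= convolve psi (fun w =>
    gauss11 i s w + (- 2 * l * gauss1 i s w + l ^+ 2 * gauss s w)) x.
  apply: Rintegral_ge0 => z _; apply: mulr_ge0 => //.
  rewrite (_ : _ + _ = ((x - row_of z) 0 i / s + l) ^+ 2 * gauss s (x - row_of z)).
    by rewrite mulr_ge0 ?sqr_ge0 ?gauss_ge0.
  by rewrite /gauss11 /gauss1; ring.
have bA : bounded_kernel (fun w => - 2 * l * gauss1 i s w) by exact: bounded_kernelZ.
have bB : bounded_kernel (fun w => l ^+ 2 * gauss s w) by exact: bounded_kernelZ.
have bAB := bounded_kernelD bA bB.
move: H; rewrite !convolveD//.
rewrite !convolveZ// -/(heat1 i s x) -/(heat11 i s x) -/(heat s x).
have -> : heat11 i s x + (- 2 * l * heat1 i s x + l ^+ 2 * heat s x) =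
  heat11 i s x - heat1 i s x ^+ 2 / heat s x.
  by rewrite /l; field; rewrite gt_eqF.
by rewrite subr_ge0 ler_pdivrMr// mulrC.
Qed.

Lemma heattE s x : 0 < s ->
  2 * heatt s x = \sum_i heat2 i s x + n%:R / s * heat s x.
Proof.
move=> s0; have [bt bi] := bounded_gauss_kernels s0.
have bg := @bounded_gauss R n s s0.
rewrite /heatt -convolveZ// (_ : (fun w => _) =
  (fun w => \sum_i gauss2 i s w + n%:R / s * gauss s w)); last first.
  by apply/funext => w; exact: gausstE.
rewrite convolveD//; last exact: bounded_kernelZ.
  by rewrite convolveZ// convolve_sum// => i; have [] := bi i.
by apply: bounded_kernel_sum => i; have [] := bi i.
Qed.

Lemma is_derive_heat i s x t : 0 < s ->
  is_derive t 1 (fun t => heat s (x + t *: e_ i)) (heat1 i s (x + t *: e_ i)).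
Proof.
move=> s0; have [_ /(_ i)[[m1 [C HC]] _ _]] := bounded_gauss_kernels s0.
rewrite (_ : (fun t => _) = fun t => convolve psi (fun w => gauss s (w + t *: e_ i)) x).
  rewrite /heat1 convolve_shift.
  apply: (@convolve_is_derive _ _ _ psi_ge0 psi_int (fun t w => gauss s (w + t *: e_ i))
    (fun t w => gauss1 i s (w + t *: e_ i)) t 1 C) => //.
  - by move=> t' _; apply: bounded_kernel_shift; exact: bounded_gauss.
  - by move=> t' w _; exact: is_derive_gauss.
by apply/funext => t'; exact: convolve_shift.
Qed.

Lemma is_derive_heat1 i s x t : 0 < s ->
  is_derive t 1 (fun t => heat1 i s (x + t *: e_ i)) (heat2 i s (x + t *: e_ i)).
Proof.
move=> s0; have [_ /(_ i)[b1 [m2 [C HC]] _]] := bounded_gauss_kernels s0.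
rewrite (_ : (fun t => _) = fun t => convolve psi (fun w => gauss1 i s (w + t *: e_ i)) x).
  rewrite /heat2 convolve_shift.
  apply: (@convolve_is_derive _ _ _ psi_ge0 psi_int (fun t w => gauss1 i s (w + t *: e_ i))
    (fun t w => gauss2 i s (w + t *: e_ i)) t 1 C) => //.
  - by move=> t' _; exact: bounded_kernel_shift.
  - by move=> t' w _; exact: is_derive_gauss1.
by apply/funext => t'; exact: convolve_shift.
Qed.

Lemma is_derive_heatt s x : 0 < s ->
  is_derive s 1 (fun s => heat s x) (heatt s x).
Proof.
move=> s0; have s20 : 0 < s / 2 by rewrite divr_gt0.
have [C C0 HC] := @gauss_dominated R n (s / 2) (s + s / 2) (s + s) s20 ltac:(lra) ltac:(lra).
have v0 : sqnorm (0 : 'rV[R]_n) <= 1 by rewrite /sqnorm dotp0l.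
have ball s' : `|s' - s| < s / 2 -> s / 2 <= s' <= s + s / 2.
  by rewrite ltr_distl => /andP[h1 h2]; apply/andP; split; lra.
have pos s' : `|s' - s| < s / 2 -> 0 < s'.
  by move=> /ball/andP[h _]; exact: lt_le_trans h.
apply: (@convolve_is_derive _ _ _ psi_ge0 psi_int (fun s w => gauss s w)
  (fun s w => gausst s w) s (s / 2) C) => //.
- by move=> s' /pos; exact: bounded_gauss.
- by move=> s' w /pos; exact: is_derive_gausst.
- move=> s' w /ball hs; have [_ + _] := HC s' w 0 hs v0.
  rewrite addr0 => /le_trans; apply.
  by rewrite ler_piMr ?gauss_le1 ?addr_gt0// ltW.
Qed.

Lemma measurable_heat_derivatives s : 0 < s ->
  measurable_rV (heatt s) /\
  forall i, measurable_rV (heat1 i s) /\ measurable_rV (heat2 i s).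
Proof.
move=> s0; have [bt bi] := bounded_gauss_kernels s0.
split=> [|i]; first exact: measurable_convolve.
by have [b1 b2 _] := bi i; split; exact: measurable_convolve.
Qed.

End heat_derivatives.

(** * Exponentially tilted powers of the heat flow *)

Section tilt.
Context {R : realType} {n : nat} (psi : 'rV[R]_n -> R).
Hypothesis psi_ge0 : forall x, 0 <= psi x.
Hypothesis psi_int : integrable_rV psi.
Hypothesis psi_gt0 : 0 < Rintegral_rV psi.
Variable q : R.
Hypothesis q1 : 1 < q.
Implicit Types (w v x b : 'rV[R]_n) (s t : R).
Local Notation heat := (heat psi).
Local Notation heat1 := (heat1 psi).
Local Notation heat2 := (heat2 psi).
Local Notation heatt := (heatt psi).
Local Notation heat11 := (heat11 psi).
Local Notation e_ i := (delta_mx 0 i : 'rV[R]_n).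
Let hgt0 s x := @heat_gt0 R n psi psi_ge0 psi_int psi_gt0 s x.

(** In the rescaled variables [tilt b s] is the density of [d phi^{p,y}] before
    normalisation.  The other definitions multiply it by the quotients by [h] of
    [d_i h], [d_ii h], [d_s h] and [(d_i h)^2 / h], where [h] is [heat s]. *)
Definition tilt b s x : R := expR (dotp x b) * heat s x `^ q.
Definition tilt1 i b s x : R := tilt b s x * (heat1 i s x / heat s x).
Definition tilt2 i b s x : R := tilt b s x * (heat2 i s x / heat s x).
Definition tiltt b s x : R := tilt b s x * (heatt s x / heat s x).
Definition tilt11 i b s x : R := tilt b s x * (heat1 i s x / heat s x) ^+ 2.

Let q0 : 0 < q. Proof. exact: lt_trans q1. Qed.

Lemma tilt_gt0 b s x : 0 < s -> 0 < tilt b s x.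
Proof. by move=> s0; rewrite mulr_gt0 ?expR_gt0 ?powR_gt0 ?hgt0. Qed.

Lemma measurable_tilt b s : 0 < s -> measurable_rV (tilt b s).
Proof. exact: measurable_laplace. Qed.

Lemma measurable_tilts b s : 0 < s ->
  measurable_rV (tiltt b s) /\
  forall i, [/\ measurable_rV (tilt1 i b s), measurable_rV (tilt2 i b s) &
      measurable_rV (tilt11 i b s)].
Proof.
move=> s0; have [mt mi] := measurable_heat_derivatives psi_ge0 psi_int s0.
have mh := measurable_heat psi_ge0 psi_int s0.
have mV : measurable_rV (fun x => (heat s x)^-1).
  rewrite (_ : (fun x => _) = fun x => heat s x `^ (-1)); last first.
    by apply/funext => x; rewrite powR_inv1// ltW// hgt0.
  exact: (measurableT_comp (measurable_powR (-1)) mh).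
have mT := @measurable_tilt b s s0.
split; first exact: (measurable_funM mT (measurable_funM mt mV)).
move=> i; have [m1 m2] := mi i.
split; apply: (measurable_funM mT).
- exact: (measurable_funM m1 mV).
- exact: (measurable_funM m2 mV).
- by apply: measurable_funX; exact: (measurable_funM m1 mV).
Qed.

Lemma tilt_le b s s' x : 0 < s -> s <= s' -> tilt b s x <= tilt b s' x.
Proof.
move=> s0 ss'; rewrite /tilt; apply: ler_wpM2l; first exact: expR_ge0.
apply: ge0_ler_powR; first exact: ltW.
- by rewrite nnegrE ltW// hgt0.
- by rewrite nnegrE ltW// hgt0// (lt_le_trans s0).
- exact: heat_le.
Qed.

(** The domain in the dual variable is the same at all positive variances:
    forwards by Jensen's inequality, backwards by monotonicity. *)
Lemma laplace_lty b s s' : 0 < s -> 0 < s' ->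
  (laplace psi q s b < +oo)%E -> (laplace psi q s' b < +oo)%E.
Proof.
move=> s0 s'0 H; have [ss'|s's] := ltP s s'.
  rewrite -(subrKC s s') laplace_add_lty// subr_gt0//.
apply: le_lt_trans H; apply: ge0_le_integral_rV.
- exact: measurable_tilt.
- exact: measurable_tilt.
- by move=> x; rewrite ltW// tilt_gt0.
- by move=> x; exact: tilt_le.
Qed.

Lemma integrable_tilt b s s' : 0 < s -> 0 < s' ->
  (laplace psi q s b < +oo)%E -> integrable_rV (tilt b s').
Proof.
move=> s0 s'0 H; apply: ge0_integrable_rV.
- exact: measurable_tilt.
- by move=> x; rewrite ltW// tilt_gt0.
- exact: laplace_lty H.
Qed.

Lemma is_derive_expdot b x i t :
  is_derive t 1 (fun t => expR (dotp (x + t *: e_ i) b))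
    (b 0 i * expR (dotp (x + t *: e_ i) b)).
Proof.
have E t' : dotp (x + t' *: e_ i) b = dotp x b + t' * b 0 i.
  by rewrite dotpDl dotpZl (dotpC (e_ i)) dotp_delta.
rewrite E; under eq_fun do rewrite E.
apply: is_derive_eq; rewrite /GRing.scale/= ?(mulr0, mulr1, add0r, addr0).
by ring.
Qed.

Lemma is_derive_heat_powR i s x t (a : R) : 0 < s ->
  let y := x + t *: e_ i in
  is_derive t 1 (fun t => heat s (x + t *: e_ i) `^ a)
    (a * heat s y `^ a * (heat1 i s y / heat s y)).
Proof.
move=> s0 y; have h0 := hgt0 y s0.
have D := is_derive_heat psi_ge0 psi_int i x t s0.
have D' := is_derive1_powR a h0.
have := is_derive1_comp (f := fun z : R => z `^ a) (g := fun t => heat s (x + t *: e_ i)) D' D.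
move=> /is_derive_eq; apply.
have -> : heat s y `^ (a - 1) = heat s y `^ a / heat s y.
  by rewrite powRB ?powRr1 ?(ltW h0)// (gt_eqF h0) implybT.
by field; rewrite gt_eqF.
Qed.

Lemma is_derive_tilt i b s x t : 0 < s ->
  is_derive t 1 (fun t => tilt b s (x + t *: e_ i))
    (b 0 i * tilt b s (x + t *: e_ i) + q * tilt1 i b s (x + t *: e_ i)).
Proof.
move=> s0.
have D := is_derive_expdot b x i t.
have D' := is_derive_heat_powR i x t q s0.
rewrite /tilt1 /tilt; apply: is_derive_eq; rewrite /GRing.scale/=.
by ring.
Qed.

Lemma is_derive_tilt1 i b s x t : 0 < s ->
  let y := x + t *: e_ i in
  is_derive t 1 (fun t => tilt1 i b s (x + t *: e_ i))
    (b 0 i * tilt1 i b s y + (q - 1) * tilt11 i b s y + tilt2 i b s y).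
Proof.
move=> s0 y; have h0 := hgt0 y s0.
have D := is_derive_tilt i b x t s0.
have D' := is_derive_heat_powR i x t (-1) s0.
have D1 := is_derive_heat1 psi_ge0 psi_int i x t s0.
rewrite /tilt1 (_ : (fun t => _) = fun t => tilt b s (x + t *: e_ i) *
  (heat1 i s (x + t *: e_ i) * heat s (x + t *: e_ i) `^ (-1))); last first.
  by apply/funext => t'; rewrite (powR_inv1 (ltW (hgt0 _ s0))).
apply: is_derive_eq; rewrite /GRing.scale/= -/y.
rewrite (powR_inv1 (ltW h0)) /tilt11 /tilt2 /tilt1.
by field; rewrite gt_eqF.
Qed.

End tilt.

(** * Integration by parts *)

Section ibp.
Context {R : realType} {n : nat}.
Implicit Types (f g : 'rV[R]_n -> R).
Local Notation e_ i := (delta_mx 0 i : 'rV[R]_n).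

(** By translation invariance the integral of [f (x + t e_i)] does not depend on
    [t]; differentiating it under the integral sign gives the integration by
    parts formula without boundary terms, for a domination of [f'] that is
    uniform over short translations. *)
Lemma Rintegral_rV_partial f f' g (i : 'I_n) :
  integrable_rV f -> integrable_rV g ->
  (forall x (t : R), is_derive t 1 (fun t : R => f (x + t *: e_ i)) (f' (x + t *: e_ i))) ->
  (forall x (t : R), `|t| < 1 -> `|f' (x + t *: e_ i)| <= g x) ->
  Rintegral_rV f' = 0.
Proof.
move=> fi gi df f'g.
have shift v : integrable_rV (fun x => f (x + v)) /\
    Rintegral_rV (fun x => f (x + v)) = Rintegral_rV f.
  have := integrable_rV_affine v ltr01 fi; have := Rintegral_rV_affine v ltr01 fi.
  under eq_Rintegral_rV do rewrite scale1r; rewrite expr1n invr1 mul1r => ->.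
  by under eq_fun do rewrite scale1r.
have [_] : is_derive (0 : R) 1 (fun t : R => Rintegral_rV (fun x => f (x + t *: e_ i)))
    (Rintegral_rV (fun x => f' (x + 0 *: e_ i))).
  apply: (@is_derive_Rintegral_rV _ _ (fun t x => f (x + t *: e_ i))
    (fun t x => f' (x + t *: e_ i)) 0 1 g) => //.
  - by move=> t _; have [] := shift (t *: e_ i).
  - by move=> t x; rewrite subr0; exact: f'g.
under eq_Rintegral_rV do rewrite scale0r addr0; move=> <-.
rewrite (_ : (fun t => _) = cst (Rintegral_rV f)) ?derive_cst//.
by apply/funext => t; have [] := shift (t *: e_ i).
Qed.

(** The sup norm is attained at some coordinate with some sign, so that the left
    side is one of the terms on the right. *)
Lemma expR_norm_le (e : R) (x : 'rV[R]_n) : 0 <= e ->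
  expR (e * `|x|) <= 1 + \sum_i (expR (e * x 0 i) + expR (- (e * x 0 i))).
Proof.
move=> e0; have S0 (P : pred 'I_n) :
    0 <= \sum_(i | P i) (expR (e * x 0 i) + expR (- (e * x 0 i))).
  by apply: sumr_ge0 => i _; rewrite addr_ge0// expR_ge0.
have [->|/mx_norm_neq0[[j i] /= xi]] := eqVneq `|x| 0.
  by rewrite mulr0 expR0 lerDl S0.
rewrite [X in expR (e * X)](xi : `|x| = _) (bigD1 i)//= (ord1 j).
have [xp|xn] := leP 0 (x 0 i).
  have := S0 (predC1 i); have := expR_ge0 (- (e * x 0 i)).
  by rewrite ger0_norm//=; lra.
have := S0 (predC1 i); have := expR_ge0 (e * x 0 i).
by rewrite ltr0_norm// mulrN /=; lra.
Qed.

End ibp.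

Section tilt_integrals.
Context {R : realType} {n : nat} (psi : 'rV[R]_n -> R).
Hypothesis psi_ge0 : forall x, 0 <= psi x.
Hypothesis psi_int : integrable_rV psi.
Hypothesis psi_gt0 : 0 < Rintegral_rV psi.
Variable q : R.
Hypothesis q1 : 1 < q.
Implicit Types (w v x b : 'rV[R]_n) (s t : R).
Local Notation heat := (heat psi).
Local Notation tilt := (tilt psi q).
Local Notation tilt1 := (tilt1 psi q).
Local Notation tilt2 := (tilt2 psi q).
Local Notation tiltt := (tiltt psi q).
Local Notation tilt11 := (tilt11 psi q).
Local Notation e_ i := (delta_mx 0 i : 'rV[R]_n).
Let hgt0 s x := @heat_gt0 R n psi psi_ge0 psi_int psi_gt0 s x.
Let tgt0 b s x := @tilt_gt0 R n psi psi_ge0 psi_int psi_gt0 q b s x.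

(** The quotient [X / h] may be unbounded, but
    [h^q X / h = h^(q - 1) X] with [q > 1] only asks for a common bound. *)
Let powR_div_le (h X M : R) : 0 < h -> h <= M -> 0 <= X -> X <= M ->
  h `^ q * (X / h) <= M `^ q.
Proof.
move=> h0 hM X0 XM; have M0 : 0 < M by exact: lt_le_trans hM.
rewrite -(mulr_powRB1 (ltW h0)) ?(lt_trans _ q1)//.
rewrite -(mulr_powRB1 (ltW M0)) ?(lt_trans _ q1)//.
rewrite (_ : _ * _ = X * h `^ (q - 1)); last by field; rewrite gt_eqF.
apply: ler_pM => //; first exact: powR_ge0.
by apply: ge0_ler_powR => //; rewrite ?nnegrE ?ltW// subr_gt0.
Qed.

Let sqr_div_le (h h1 h11 M : R) : 0 < h -> h1 ^+ 2 <= h * h11 -> h11 <= M ->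
  `|h1 ^+ 2 / h| <= M.
Proof.
move=> h0 H hM; rewrite ger0_norm ?divr_ge0 ?sqr_ge0 ?(ltW h0)//.
by rewrite ler_pdivrMr// (le_trans H)// mulrC ler_wpM2r// ltW.
Qed.

(** The domination of [heat] and of its derivatives passes to the tilted powers,
    because each of them is [e^<x, b>] times a product of [q] factors bounded by
    [C heat s2]. *)
Lemma tilt_dominated (s0 s1 s2 : R) : 0 < s0 -> s0 <= s1 -> s1 < s2 ->
  exists2 C : R, 0 < C & forall (s : R) x v b, s0 <= s <= s1 -> sqnorm v <= 1 ->
  let D := C * expR (dotp v b) * tilt b s2 x in
  [/\ tilt b s (x + v) <= D, `|tiltt b s (x + v)| <= D &
      forall i, [/\ `|tilt1 i b s (x + v)| <= D, `|tilt2 i b s (x + v)| <= D &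
                 `|tilt11 i b s (x + v)| <= D]].
Proof.
move=> s00 s01 s12.
have [C C0 HC] := heat_dominated psi_ge0 psi_int s00 s01 s12.
exists (C `^ q) => [|s x v b ss v1 D]; first exact: powR_gt0.
have s0' : 0 < s by case/andP : ss => + _; exact: lt_le_trans.
have s20 : 0 < s2 by rewrite (lt_trans _ s12)// (lt_le_trans s00).
have h0 := hgt0 (x + v) s0'.
have N0 := hgt0 x s20.
have [hN htN hiN] := HC s x v ss v1.
have DE : D = expR (dotp (x + v) b) * (C * heat s2 x) `^ q.
  by rewrite /D /(tilt _ _ _) (powRM _ (ltW C0) (ltW N0)) dotpDl expRD; ring.
have E0 := expR_ge0 (dotp (x + v) b).
have H X : `|X| <= C * heat s2 x -> `|tilt b s (x + v) * (X / heat s (x + v))| <= D.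
  move=> XN; rewrite normrM (gtr0_norm (tgt0 _ _ s0')) normrM normfV (gtr0_norm h0).
  rewrite DE /(tilt _ _ _) -mulrA; apply: (ler_wpM2l E0).
  exact: powR_div_le.
split.
- have HH := H (heat s (x + v)).
  rewrite (gtr0_norm h0) (divff (lt0r_neq0 h0)) mulr1 in HH.
  exact: (le_trans (ler_norm _) (HH hN)).
- exact: H.
- move=> i; have [h1N h2N h11N] := hiN i; split; try exact: H.
  rewrite (_ : tilt11 _ _ _ _ = tilt b s (x + v) *
    ((heat1 psi i s (x + v) ^+ 2 / heat s (x + v)) / heat s (x + v))).
    exact: (H _ (sqr_div_le h0 (heat1_sqr_le psi_ge0 psi_int psi_gt0 i _ s0') h11N)).
  rewrite /(tilt11 _ _ _ _) expr_div_n expr2 [in X in _ * X = _](expr2 (heat s (x + v))).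
  by rewrite invfM !mulrA.
Qed.

Section at_one_variance.
Variables (b : 'rV[R]_n) (s : R).
Hypothesis s0 : 0 < s.
Hypothesis fin : (laplace psi q s b < +oo)%E.

Let ss : s < s + 1. Proof. by rewrite ltrDl. Qed.
Let sp : 0 < s + 1. Proof. by rewrite addr_gt0. Qed.

Lemma integrable_tilts :
  integrable_rV (tiltt b s) /\
  forall i, [/\ integrable_rV (tilt1 i b s), integrable_rV (tilt2 i b s) &
      integrable_rV (tilt11 i b s)].
Proof.
have [C C0 HC] := tilt_dominated s0 (lexx _) ss.
have v0 : sqnorm (0 : 'rV[R]_n) <= 1 by rewrite /sqnorm dotp0l.
have sss : s <= s <= s by rewrite lexx.
have Gi : integrable_rV (fun x => C * expR (dotp (0 : 'rV[R]_n) b) * tilt b (s + 1) x).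
  by apply: integrable_rVZl; exact: (integrable_tilt psi_ge0 psi_int psi_gt0 q1 s0 sp fin).
have [mt mi] := measurable_tilts psi_ge0 psi_int psi_gt0 q b s0.
split=> [|i].
  apply: (le_integrable_rV mt Gi) => x.
  by have [_ + _] := HC s x 0 b sss v0; rewrite addr0.
have [m1 m2 m11] := mi i.
split; [apply: (le_integrable_rV m1 Gi)|apply: (le_integrable_rV m2 Gi)|
  apply: (le_integrable_rV m11 Gi)] => x.
- by have [_ _ /(_ i)[+ _ _]] := HC s x 0 b sss v0; rewrite addr0.
- by have [_ _ /(_ i)[_ + _]] := HC s x 0 b sss v0; rewrite addr0.
- by have [_ _ /(_ i)[_ _ +]] := HC s x 0 b sss v0; rewrite addr0.
Qed.

Let dominated_shift (i : 'I_n) : exists2 g, integrable_rV g & forall x t, `|t| < 1 ->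
  let y := x + t *: e_ i in
  [/\ `|tilt b s y| <= g x, `|tilt1 i b s y| <= g x, `|tilt2 i b s y| <= g x &
      `|tilt11 i b s y| <= g x].
Proof.
have [C C0 HC] := tilt_dominated s0 (lexx _) ss.
have sss : s <= s <= s by rewrite lexx.
exists (fun x => C * expR `|b 0 i| * tilt b (s + 1) x).
  by apply: integrable_rVZl; exact: (integrable_tilt psi_ge0 psi_int psi_gt0 q1 s0 sp fin).
move=> x t t1 y.
have v1 : sqnorm (t *: e_ i) <= 1.
  rewrite sqnormZ /sqnorm dotp_delta mxE !eqxx mulr1.
  by rewrite -real_normK ?num_real// expr_le1// ltW.
have le : C * expR (dotp (t *: e_ i) b) * tilt b (s + 1) x <=
    C * expR `|b 0 i| * tilt b (s + 1) x.
  apply: ler_wpM2r; first by rewrite ltW// tgt0.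
  apply: ler_wpM2l; first exact: ltW.
  rewrite ler_expR dotpZl dotpC dotp_delta (le_trans (ler_norm _))// normrM.
  by rewrite ler_piMl// ltW.
have [A _ /(_ i)[B1 B2 B3]] := HC s x _ b sss v1.
split; apply: (le_trans _ le) => //.
by rewrite gtr0_norm// tgt0.
Qed.

(** [int d_i P = 0] for [P = e^<x, b> h^q]. *)
Lemma Rintegral_tilt1 i :
  b 0 i * Rintegral_rV (tilt b s) + q * Rintegral_rV (tilt1 i b s) = 0.
Proof.
have [g gi Hg] := dominated_shift i.
have [_ /(_ i)[i1 i2 i11]] := integrable_tilts.
have i0 := integrable_tilt psi_ge0 psi_int psi_gt0 q1 s0 s0 fin.
rewrite -!Rintegral_rVZl// -Rintegral_rVD; try exact: integrable_rVZl.
apply: (@Rintegral_rV_partial _ _ (tilt b s) _ (fun x => (`|b 0 i| + `|q|) * g x) i) => //.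
- exact: integrable_rVZl.
- by move=> x t; exact: is_derive_tilt.
- move=> x t t1; have [A B _ _] := Hg x t t1.
  rewrite mulrDl; apply: (le_trans (ler_normD _ _)).
  rewrite (normrM (b 0 i)) (normrM q).
  by apply: lerD; apply: ler_wpM2l => //; exact: normr_ge0.
Qed.

(** [int d_i (P d_i h / h) = 0]. *)
Lemma Rintegral_tilt2 i :
  b 0 i * Rintegral_rV (tilt1 i b s) + (q - 1) * Rintegral_rV (tilt11 i b s)
    + Rintegral_rV (tilt2 i b s) = 0.
Proof.
have [g gi Hg] := dominated_shift i.
have [_ /(_ i)[i1 i2 i11]] := integrable_tilts.
have j1 := integrable_rVZl (b 0 i) i1; have j11 := integrable_rVZl (q - 1) i11.
have j := integrable_rVD j1 j11.
rewrite -!Rintegral_rVZl// -!Rintegral_rVD//.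
apply: (@Rintegral_rV_partial _ _ (tilt1 i b s) _
  (fun x => (`|b 0 i| + `|q - 1| + 1) * g x) i) => //.
- exact: integrable_rVZl.
- by move=> x t; exact: is_derive_tilt1.
- move=> x t t1; have [_ A B D] := Hg x t t1.
  rewrite [leRHS]mulrDl mul1r; apply: (le_trans (ler_normD _ _)); apply: lerD => //.
  rewrite [leRHS]mulrDl; apply: (le_trans (ler_normD _ _)).
  rewrite (normrM (b 0 i)) (normrM (q - 1)).
  by apply: lerD; apply: ler_wpM2l => //; exact: normr_ge0.
Qed.

(** The heat equation, multiplied by [P / h] and integrated. *)
Lemma Rintegral_tiltt :
  2 * Rintegral_rV (tiltt b s) =
  \sum_i Rintegral_rV (tilt2 i b s) + n%:R / s * Rintegral_rV (tilt b s).
Proof.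
have i0 := integrable_tilt psi_ge0 psi_int psi_gt0 q1 s0 s0 fin.
have [it ii] := integrable_tilts.
have i2 i : integrable_rV (tilt2 i b s) by have [] := ii i.
rewrite -Rintegral_rV_sum// -!Rintegral_rVZl// -Rintegral_rVD//; last 2 first.
- exact: integrable_rV_sum.
- exact: integrable_rVZl.
apply: eq_Rintegral_rV => x; have h0 := hgt0 x s0.
rewrite /(tilt2 _ _ _ _) -mulr_sumr -mulr_suml /(tiltt _ _ _).
rewrite mulrCA (mulrA 2) (heattE psi_ge0 psi_int x s0).
by field; rewrite !gt_eqF.
Qed.

End at_one_variance.
End tilt_integrals.

(** * Functions with a quadratic remainder *)

Section quadratic_remainder.
Context {R : realType} {n : nat}.
Implicit Types (m k x : 'rV[R]_n).

(** The candidate differential, with the varying argument last. *)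
Definition dotpr m k : R := dotp k m.

Fact dotpr_linear m : linear (dotpr m).
Proof. by move=> c x y; rewrite /dotpr dotpDl dotpZl. Qed.

HB.instance Definition _ m :=
  GRing.isLinear.Build R 'rV[R]_n R _ (dotpr m) (dotpr_linear m).

Lemma continuous_dotpr m : continuous (dotpr m).
Proof.
apply: continuous_big => [|i _ x]; first exact: add_continuous.
by apply: continuousM; [exact: (@coord_continuous R 1 n 0 i x)|exact: cst_continuous].
Qed.

(** The bound is uniform in the direction of [k], as differentiability requires;
    partial derivatives alone would not give it. *)
Lemma quadratic_remainder_differentiable (f : 'rV[R]_n -> R) x m (C d : R) :
  0 < d -> (forall k, `|k| < d -> `|f (x + k) - f x - dotp k m| <= C * `|k| ^+ 2) ->
  differentiable f x /\ forall v, 'D_v f x = dotp v m.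
Proof.
move=> d0 H.
have E : f \o shift x = cst (f x) + dotpr m +o_ (0 : 'rV[R]_n) id.
  apply/eqaddoP => _/posnumP[e].
  pose d' := Num.min d (e%:num / (`|C| + 1)).
  have C1 : 0 < `|C| + 1 by rewrite ltr_wpDl.
  have d'0 : 0 < d' by rewrite lt_min d0 divr_gt0.
  apply: (@filterS _ _ _ _ _ _ (@nbhs0_lt R 'rV[R]_n d' d'0)) => k kd'.
  have := kd'; rewrite lt_min => /andP[kd ke].
  rewrite /= !fctE/= (addrC k).
  rewrite [X in `|X|](_ : _ = f (x + k) - f x - dotp k m); last first.
    by rewrite /dotpr; ring.
  rewrite (le_trans (H k kd))// expr2 mulrA ler_wpM2r//.
  rewrite (@le_trans _ _ ((`|C| + 1) * `|k|))//.
    by rewrite ler_wpM2r// (le_trans (ler_norm _))// lerDl.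
  by rewrite mulrC -ler_pdivlMr// ltW.
have D := diff_unique (@continuous_dotpr m) E.
have df : differentiable f x.
  by apply/diff_locallyP; rewrite D; split => //; exact: continuous_dotpr.
by split => // v; rewrite deriveE// D.
Qed.

End quadratic_remainder.

(** * Differentiation in the dual variable and in time *)

Section moments.
Context {R : realType} {n : nat} (psi : 'rV[R]_n -> R).
Hypothesis psi_ge0 : forall x, 0 <= psi x.
Hypothesis psi_int : integrable_rV psi.
Hypothesis psi_gt0 : 0 < Rintegral_rV psi.
Variable q : R.
Hypothesis q1 : 1 < q.
Implicit Types (x k y : 'rV[R]_n) (s t : R).
Local Notation tilt := (tilt psi q).
Local Notation tiltt := (tiltt psi q).
Local Notation e_ i := (delta_mx 0 i : 'rV[R]_n).
Let tgt0 b s x := @tilt_gt0 R n psi psi_ge0 psi_int psi_gt0 q b s x.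
Let q0 : 0 < q. Proof. exact: lt_trans q1. Qed.

Lemma expR_taylor1 (u : R) : `|expR u - 1 - u| <= u ^+ 2 * expR `|u|.
Proof.
have e1 := expR_ge1Dx u; have e2 := expR_ge1Dx (- u).
have ep := expR_gt0 u; have en := expR_gt0 (- u).
have ee : expR u * expR (- u) = 1 by rewrite -expRD subrr expR0.
rewrite ger0_norm; last by lra.
have [up|un] := leP 0 u.
  have H : expR u - 1 <= u * expR u by rewrite -[X in _ - X <= _]ee; nra.
  by rewrite ger0_norm//; nra.
rewrite ltr0_norm//.
have H : expR u * (1 - u) <= 1 by rewrite -[leRHS]ee; nra.
have u2 : expR u - 1 - u <= u ^+ 2.
  have : (expR u - 1 - u) * (1 - u) <= u ^+ 2 * (1 - u) by nra.
  by rewrite ler_pM2r//; lra.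
rewrite (le_trans u2)// ler_peMr ?sqr_ge0//; lra.
Qed.

Lemma tiltDl (b c : 'rV[R]_n) s x : tilt (b + c) s x = expR (dotp x c) * tilt b s x.
Proof. by rewrite /(tilt _ _ _) dotpDr expRD [in RHS]mulrA (mulrC (expR (dotp x c))). Qed.

(** The sum of the tilts in the [2 n] directions [b + e e_i], [b - e e_i] and in
    [b] itself: exponential moments of [tilt b s] in the sup norm are finite
    because finitely many tilts near [b] are integrable. *)
Definition exp_dominant (e : R) b s x : R :=
  tilt b s x + \sum_i (tilt (b + e *: e_ i) s x + tilt (b + - e *: e_ i) s x).

Lemma exp_dominantP (e : R) b s x : 0 <= e -> 0 < s ->
  expR (e * `|x|) * tilt b s x <= exp_dominant e b s x.
Proof.
move=> e0 s0; have := ler_wpM2r (ltW (tgt0 b x s0)) (expR_norm_le x e0).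
move=> /le_trans; apply; rewrite mulrDl mul1r mulr_suml /exp_dominant.
rewrite le_eqVlt; apply/orP; left; apply/eqP; congr (_ + _); apply: eq_bigr => i _.
by rewrite !tiltDl !dotpZr dotp_delta mulrDl mulNr.
Qed.

Section near_direction.
Variables (b : 'rV[R]_n) (e s : R).
Hypotheses (e0 : 0 < e) (s0 : 0 < s).
Hypothesis fin : forall c, `|c - b| <= e -> (laplace psi q s c < +oo)%E.

Lemma integrable_exp_dominant s' : 0 < s' -> integrable_rV (exp_dominant e b s').
Proof.
move=> s'0.
have norm_e i : `|e *: e_ i| <= e.
  apply: norm_le_coord => [|j]; first exact: ltW.
  rewrite !mxE normrM (gtr0_norm e0) ler_piMr// ?(ltW e0)//.
  by case: (_ && _); rewrite ?normr1 ?normr0.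
have I c : `|c - b| <= e -> integrable_rV (tilt c s').
  by move=> /fin; exact: integrable_tilt.
apply: integrable_rVD; first by apply: I; rewrite subrr normr0 ltW.
apply: integrable_rV_sum => i; apply: integrable_rVD; apply: I.
  by rewrite addrC addKr.
by rewrite addrC addKr scaleNr normrN.
Qed.

Lemma norm_le_exp (a : R) x : 0 < a -> `|x| <= a^-1 * expR (a * `|x|).
Proof.
move=> a0; rewrite -ler_pdivrMl ?invr_gt0// invrK.
by rewrite (le_trans _ (expR_ge1Dx _))// lerDr.
Qed.

Lemma integrable_coord_tilt i s' : 0 < s' -> integrable_rV (fun x => x 0 i * tilt b s' x).
Proof.
move=> s'0; apply: (@le_integrable_rV _ _ _ (fun x => e^-1 * exp_dominant e b s' x)).
- apply: measurable_funM; first exact: measurable_coord.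
  exact: (measurable_tilt psi_ge0 psi_int q b s'0).
- by apply: integrable_rVZl; exact: integrable_exp_dominant.
- move=> x; rewrite (normrM (x 0 i)) (gtr0_norm (tgt0 b x s'0)).
  apply: (@le_trans _ _ (e^-1 * (expR (e * `|x|) * tilt b s' x))).
    rewrite (mulrA e^-1); apply: ler_wpM2r; first exact: ltW (tgt0 b x s'0).
    exact: le_trans (coord_le_norm x i) (norm_le_exp x e0).
  apply: ler_wpM2l; first by rewrite invr_ge0 ltW.
  exact: exp_dominantP (ltW e0) s'0.
Qed.

Lemma Rintegral_dotp_tilt y s' : 0 < s' ->
  integrable_rV (fun x => dotp x y * tilt b s' x) /\
  Rintegral_rV (fun x => dotp x y * tilt b s' x) =
  dotp y (\row_i Rintegral_rV (fun x => x 0 i * tilt b s' x)).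
Proof.
move=> s'0; have ci i := integrable_rVZl (y 0 i) (integrable_coord_tilt i s'0).
have E : (fun x => dotp x y * tilt b s' x) =
    (fun x => \sum_i y 0 i * (x 0 i * tilt b s' x)).
  apply/funext => x; rewrite mulr_suml; apply: eq_bigr => i _.
  by rewrite mulrA (mulrC (y 0 i)).
rewrite E; split; first exact: integrable_rV_sum.
rewrite Rintegral_rV_sum//; apply: eq_bigr => i _.
by rewrite Rintegral_rVZl ?mxE//; exact: integrable_coord_tilt.
Qed.

Let d : R := e / (2 * n.+1%:R).

Let d0 : 0 < d. Proof. by rewrite divr_gt0// mulr_gt0// ltr0n. Qed.

Let dotp_small k x : `|k| <= d -> `|dotp x k| <= (e / 2) * `|x|.
Proof.
move=> kd; rewrite (le_trans (dotp_le_norm _ _))// ler_wpM2r//.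
rewrite (@le_trans _ _ (n.+1%:R * d))//.
  by apply: ler_pM => //; rewrite ler_nat.
have N0 : (n.+1%:R : R) != 0 by rewrite pnatr_eq0.
by rewrite le_eqVlt /d; apply/orP; left; apply/eqP; move: (n.+1%:R : R) N0 => N N0; field.
Qed.

(** The first-order expansion of [e^<x, k>] is integrated.  The remainder
    costs a factor [|x|^2 e^(e / 2 |x|)], which is an exponential moment of order
    [e]; this fixes the radius [d] of the dual ball. *)
Lemma Rintegral_tilt_taylor : exists C, forall k, `|k| < d ->
  `|Rintegral_rV (tilt (b + k) s) - Rintegral_rV (tilt b s)
    - dotp k (\row_i Rintegral_rV (fun x => x 0 i * tilt b s x))| <= C * `|k| ^+ 2.
Proof.
pose C := n%:R ^+ 2 * (16 / e ^+ 2).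
exists (C * Rintegral_rV (exp_dominant e b s)) => k kd.
have de : d <= e.
  by rewrite /d ler_pdivrMr ?mulr_gt0// ler_peMr ?(ltW e0)// -natrM ler1n.
have [di <-] := Rintegral_dotp_tilt k s0.
have bi : integrable_rV (tilt b s).
  by apply: (integrable_tilt psi_ge0 psi_int psi_gt0 q1 s0 s0); apply: fin;
    rewrite subrr normr0 ltW.
have ki : integrable_rV (tilt (b + k) s).
  apply: (integrable_tilt psi_ge0 psi_int psi_gt0 q1 s0 s0); apply: fin.
  by rewrite addrC addKr (le_trans (ltW kd)).
have bNi := integrable_rVZl (-1) bi; have dNi := integrable_rVZl (-1) di.
rewrite -(mulN1r (Rintegral_rV (tilt b s))) -(mulN1r (Rintegral_rV (fun x => _))).
rewrite -(Rintegral_rVZl (-1) bi) -(Rintegral_rVZl (-1) di).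
have kbi := integrable_rVD ki bNi.
rewrite -(Rintegral_rVD ki bNi) -(Rintegral_rVD kbi dNi).
have Di := integrable_exp_dominant s0.
rewrite -mulrA (mulrC (Rintegral_rV _)) mulrA -(Rintegral_rVZl (C * `|k| ^+ 2) Di).
apply: norm_Rintegral_rV.
- exact: integrable_rV_measurable (integrable_rVD kbi dNi).
- exact: integrable_rVZl.
- move=> x; rewrite tiltDl; set T := tilt b s x; set u := dotp x k.
  rewrite (_ : _ + _ = (expR u - 1 - u) * T); last by ring.
  have T0 : 0 <= T by exact: ltW (tgt0 b x s0).
  rewrite (normrM (expR u - 1 - u)) (ger0_norm T0).
  apply: (@le_trans _ _ (C * `|k| ^+ 2 * (expR (e * `|x|) * T))); last first.
    apply: ler_wpM2l; last exact: exp_dominantP (ltW e0) s0.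
    by rewrite !mulr_ge0 ?exprn_ge0// invr_ge0 exprn_ge0// ltW.
  rewrite (mulrA (C * `|k| ^+ 2)); apply: (ler_wpM2r T0); apply: (le_trans (expR_taylor1 u)).
  have u1 : `|u| <= n%:R * `|k| * `|x| by exact: dotp_le_norm.
  have u2 : `|u| <= e / 2 * `|x| by apply: dotp_small; exact: ltW.
  have X : `|x| ^+ 2 <= 16 / e ^+ 2 * expR (e / 2 * `|x|).
    rewrite -[e / 2 * _](_ : e / 4 * `|x| + e / 4 * `|x| = _); last by field.
    rewrite expRD; have e4 : 0 < e / 4 by rewrite divr_gt0.
    have H := norm_le_exp x e4.
    rewrite (_ : 16 / e ^+ 2 = (e / 4)^-1 ^+ 2); last by field; rewrite gt_eqF.
    by rewrite -expr2 -exprMn !expr2; apply: ler_pM.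
  have U : u ^+ 2 <= n%:R ^+ 2 * `|k| ^+ 2 * `|x| ^+ 2.
    rewrite -!exprMn -[leLHS]real_normK ?num_real//.
    by rewrite !(expr2 (`|u|)) (expr2 (n%:R * _ * _)); apply: ler_pM.
  have kn0 : 0 <= n%:R ^+ 2 * `|k| ^+ 2 by rewrite mulr_ge0 ?exprn_ge0.
  apply: (@le_trans _ _ (n%:R ^+ 2 * `|k| ^+ 2 *
    (16 / e ^+ 2 * expR (e / 2 * `|x|)) * expR (e / 2 * `|x|))).
    apply: ler_pM; rewrite ?sqr_ge0 ?expR_ge0 ?ler_expR//.
    by rewrite (le_trans U)// ler_wpM2l.
  rewrite -mulrA -[_ * expR _ * expR _]mulrA -expRD.
  rewrite (_ : e / 2 * `|x| + e / 2 * `|x| = e * `|x|); last by field.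
  by rewrite le_eqVlt; apply/orP; left; apply/eqP; rewrite /C; ring.
Qed.

(** Derivative along a curve that moves the dual variable on the line through [y]
    and the variance at the same time.  The direction [be u *: y] stays in the
    ball where the tilt is at most [e^(e / 2 |x|)] times the one at [b], and the
    other half of the exponential moment pays for [<x, y>]. *)
Lemma is_derive_Rintegral_tilt (be be' si si' : R -> R) (y : 'rV[R]_n) (t r s1 s2 K : R) :
  0 < r -> 0 < s1 -> s1 <= s2 -> 0 <= K -> b = be t *: y ->
  (forall u, `|u - t| < r -> is_derive u 1 be (be' u)) ->
  (forall u, `|u - t| < r -> is_derive u 1 si (si' u)) ->
  (forall u, `|u - t| < r -> [/\ `|be' u| <= K, `|si' u| <= K, s1 <= si u <= s2 &
     `|be u *: y - b| <= d]) ->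
  is_derive t 1 (fun u => Rintegral_rV (tilt (be u *: y) (si u)))
    (be' t * Rintegral_rV (fun x => dotp x y * tilt b (si t) x)
     + q * si' t * Rintegral_rV (tiltt b (si t))).
Proof.
move=> r0 s10 s12 K0 bE dbe dsi H.
have tt : `|t - t| < r by rewrite subrr normr0.
have de : d <= e.
  by rewrite /d ler_pdivrMr ?mulr_gt0// ler_peMr ?(ltW e0)// -natrM ler1n.
have si0 u : `|u - t| < r -> 0 < si u.
  by move=> /H[_ _ /andP[+ _] _]; exact: lt_le_trans.
have fin' u : `|u - t| < r -> (laplace psi q s (be u *: y) < +oo)%E.
  by move=> /H[_ _ _ hb]; apply: fin; exact: le_trans de.
have s20 : 0 < s2 by exact: lt_le_trans s12.
have s3 : s2 < s2 + 1 by rewrite ltrDl.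
have s30 : 0 < s2 + 1 by rewrite addr_gt0.
have [C C0 HC] := tilt_dominated psi_ge0 psi_int psi_gt0 q1 s10 s12 s3.
have v0 : sqnorm (0 : 'rV[R]_n) <= 1 by rewrite /sqnorm dotp0l.
have dom u x : `|u - t| < r ->
    tilt (be u *: y) (si u) x <= C * (expR (e / 2 * `|x|) * tilt b (s2 + 1) x) /\
    `|tiltt (be u *: y) (si u) x| <= C * (expR (e / 2 * `|x|) * tilt b (s2 + 1) x).
  move=> ur; have [_ _ hsi hb] := H u ur.
  have [] := HC (si u) x 0 (be u *: y) hsi v0.
  rewrite addr0 dotp0l expR0 mulr1 -[X in C * tilt X _ _](subrKC b) tiltDl => A B _.
  have L : C * (expR (dotp x (be u *: y - b)) * tilt b (s2 + 1) x) <=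
      C * (expR (e / 2 * `|x|) * tilt b (s2 + 1) x).
    apply: ler_wpM2l; first exact: ltW.
    apply: ler_wpM2r; first exact: ltW (tgt0 b x s30).
    by rewrite ler_expR (le_trans (ler_norm _))// dotp_small.
  by split; [exact: le_trans A L|exact: le_trans B L].
have [di _] := Rintegral_dotp_tilt y (si0 t tt).
have fb : (laplace psi q s b < +oo)%E by rewrite bE; exact: fin'.
have fb' := laplace_lty psi_ge0 psi_int psi_gt0 q1 s0 (si0 t tt) fb.
have [ti _] := integrable_tilts psi_ge0 psi_int psi_gt0 q1 (si0 t tt) fb'.
rewrite -(Rintegral_rVZl _ di) -(Rintegral_rVZl _ ti).
rewrite -(Rintegral_rVD (integrable_rVZl _ di) (integrable_rVZl _ ti)) bE.
pose K' := (K * (n%:R * `|y|) * (e / 2)^-1 + q * K) * C.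
apply: (@is_derive_Rintegral_rV _ _ (fun u x => tilt (be u *: y) (si u) x)
  (fun u x => be' u * (dotp x y * tilt (be u *: y) (si u) x) +
     q * si' u * tiltt (be u *: y) (si u) x)
  t r (fun x => K' * exp_dominant e b (s2 + 1) x)) => //.
- move=> u ur; exact: (integrable_tilt psi_ge0 psi_int psi_gt0 q1 s0 (si0 u ur) (fin' u ur)).
- move=> u x ur; have h0 := heat_gt0 psi_ge0 psi_int psi_gt0 x (si0 u ur).
  have Db := dbe u ur.
  have D1 : is_derive u 1 (fun u => expR (dotp x (be u *: y)))
      (expR (dotp x (be u *: y)) * (be' u * dotp x y)).
    rewrite dotpZr; under eq_fun do rewrite dotpZr.
    by apply: is_derive_eq; rewrite /GRing.scale/= ?(mulr0, add0r, addr0) (mulrC (dotp x y)).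
  have D2 := is_derive1_comp (f := fun s => heat psi s x) (g := si)
    (is_derive_heatt psi_ge0 psi_int x (si0 u ur)) (dsi u ur).
  have D3 := is_derive1_comp (f := fun z : R => z `^ q) (g := fun s => heat psi (si s) x)
    (is_derive1_powR q h0) D2.
  have D4 : is_derive u 1 (fun u => tilt (be u *: y) (si u) x) _ := is_deriveM D1 D3.
  apply: (is_derive_eq D4); rewrite /GRing.scale/=.
  have -> : heat psi (si u) x `^ (q - 1) = heat psi (si u) x `^ q / heat psi (si u) x.
    by rewrite powRB ?powRr1 ?(ltW h0)// (gt_eqF h0) implybT.
  by rewrite /(tiltt _ _ _) /(tilt _ _ _); field; rewrite gt_eqF.
- by apply: integrable_rVZl; exact: integrable_exp_dominant.
- move=> u x ur; have [hb hs _ _] := H u ur; have [A B] := dom u x ur.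
  have T0 := tgt0 (be u *: y) x (si0 u ur).
  have ED := exp_dominantP b x (ltW e0) s30.
  have E0 := ltW (tgt0 b x s30).
  have N := @norm_le_exp (e / 2) x (divr_gt0 e0 (ltr0n _ 2)).
  have Y := dotp_le_norm x y.
  have EE : expR (e * `|x|) = expR (e / 2 * `|x|) * expR (e / 2 * `|x|).
    by rewrite -expRD; congr expR; field.
  have E1 : 1 <= expR (e / 2 * `|x|).
    by rewrite -expR0 ler_expR mulr_ge0// divr_ge0// ltW.
  move: A B T0 E0 N E1 EE ED; rewrite /K'.
  move: (tilt _ _ _) (tiltt _ _ _) (tilt _ _ _) (exp_dominant _ _ _ _) (expR _) (expR _).
  move=> T Tt T' D E E' A B T0 E0 N E1 -> ED.
  have Ny : 0 <= n%:R * `|y| by rewrite mulr_ge0.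
  have a0 : 0 <= (e / 2)^-1 by rewrite invr_ge0 divr_ge0// ltW.
  have CT : 0 <= C * T by rewrite mulr_ge0// ltW.
  have X : `|dotp x y| <= n%:R * `|y| * ((e / 2)^-1 * E').
    by rewrite (le_trans Y)// ler_wpM2l.
  have P1 : `|be' u * (dotp x y * T')| <=
      K * (n%:R * `|y| * ((e / 2)^-1 * E') * (C * (E' * T))).
    by rewrite normrM ler_pM// normrM ler_pM// gtr0_norm.
  have P2 : `|q * si' u * Tt| <= q * K * (C * (E' * T)).
    rewrite normrM ler_pM// normrM ler_pM// gtr0_norm//.
  have P3 : q * K * (C * (E' * T)) <= q * K * (C * (E' * E' * T)).
    rewrite !(mulrCA C) !ler_wpM2l ?(mulr_ge0 (ltW q0) K0)//.
    by apply: (ler_wpM2r CT); rewrite ler_peMr// (le_trans _ E1).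
  apply: (le_trans (ler_normD _ _)); apply: (le_trans (lerD P1 (le_trans P2 P3))).
  have K'0 : 0 <= (K * (n%:R * `|y|) / (e / 2) + q * K) * C.
    apply: mulr_ge0; last exact: ltW.
    apply: addr_ge0; last exact: mulr_ge0 (ltW q0) K0.
    exact: mulr_ge0 (mulr_ge0 K0 Ny) a0.
  apply: (le_trans _ (ler_wpM2l K'0 ED)).
  by rewrite le_eqVlt; apply/orP; left; apply/eqP; field; rewrite gt_eqF.
Qed.

End near_direction.
End moments.

(** * From the Fokker-Planck flow to the heat flow *)

Section reduction.
Context {R : realType} {n : nat}.
Implicit Types (x y z : 'rV[R]_n) (s t : R).

Lemma deriveE_line (f : 'rV[R]_n -> R) x v (l : R) :
  is_derive (0 : R) 1 (fun t : R => f (x + t *: v)) l -> 'D_v f x = l.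
Proof.
move=> [_ <-]; rewrite /derive.
suff -> : (fun h : R => h^-1 *: ((f \o shift x) (h *: v) - f x)) =
  (fun h : R => h^-1 *: (((fun t : R => f (x + t *: v)) \o shift 0) (h *: 1)
                       - f (x + 0 *: v))) by [].
apply/funext => h /=.
by rewrite scale0r !addr0 /GRing.scale/= mulr1 (addrC x).
Qed.

Section density.
Variables (psi : 'rV[R]_n -> R).
Hypothesis psi_ge0 : forall x, 0 <= psi x.
Hypothesis psi_int : integrable_rV psi.

(** By Tonelli, the mass of a convolution is the product of the masses. *)
Lemma integral_heat s : 0 < s ->
  integral_rV (fun x => (heat psi s x)%:E) =
  (Num.sqrt (2 * pi * s) ^+ n * Rintegral_rV psi)%:E.
Proof.
move=> s0; have mpsi := integrable_rV_measurable psi_int.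
have mg := @measurable_gauss R n s.
transitivity (integral_rV (fun x => integral_rV (fun z =>
    (psi z * gauss s (x - z))%:E))).
  apply: eq_integral_rV => x; rewrite EFin_Rintegral_rV; last first.
    by apply: convolve_integrable => //; exact: bounded_gauss.
  by apply: eq_integral_rV => z; rewrite mulrC.
rewrite tonelli_rV; last 2 first.
- apply/measurable_EFinP; apply: measurable_funM; last exact: measurable_convolve2.
  exact: (measurableT_comp mpsi).
- by move=> x z; rewrite lee_fin mulr_ge0// gauss_ge0.
rewrite EFinM EFin_Rintegral_rV// -ge0_integral_rVZl ?exprn_ge0 ?sqrtr_ge0//.
apply: eq_integral_rV => z; rewrite ge0_integral_rVZl//; last 2 first.
- exact: measurable_rV_shift mg.
- by move=> x; exact: gauss_ge0.
by rewrite integral_gauss// -EFinM mulrC.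
Qed.

End density.

Section solution.
Variables (phi0 : 'rV[R]_n -> \bar R) (hphi0 : Cvx phi0).

Let psi x : R := fine (expeR (- phi0 x)).

Let psiE x : (psi x)%:E = expeR (- phi0 x).
Proof. by rewrite /psi; have := Cvx_gtNy hphi0 x; case: (phi0 x). Qed.

Lemma initial_density : exists psi : 'rV[R]_n -> R,
  [/\ forall x, (psi x)%:E = expeR (- phi0 x), forall x, 0 <= psi x,
      integrable_rV psi & 0 < Rintegral_rV psi].
Proof.
exists psi; have p0 x : 0 <= psi x by rewrite -lee_fin psiE expeR_ge0.
have mphi := measurable_lsc_rV (Cvx_lsc hphi0).
have mp : measurable_rV psi.
  pose A : set (n.-tuple (measurableTypeR R)) := [set t | phi0 (row_of t) != +oo%E].
  have mA : measurable A.
    rewrite (_ : A = [set: n.-tuple (measurableTypeR R)] `&`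
        (phi0 \o row_of) @^-1` (~` [set +oo%E])).
      by apply: mphi => //; apply: measurableC; exact: emeasurable_set1.
    by rewrite setTI; apply/seteqP; split => t /= /eqP.
  rewrite /measurable_rV (_ : psi \o row_of =
      fun t : n.-tuple (measurableTypeR R) =>
        expR (fine (- phi0 (row_of t))%E) * \1_A t); last first.
    apply/funext => t /=; rewrite /psi indicE.
    have := Cvx_gtNy hphi0 (row_of t).
    rewrite (_ : (t \in A) = (phi0 (row_of t) != +oo%E)); last by apply/idP/idP; rewrite inE.
    by case: (phi0 _) => [r||] /= h; rewrite ?mulr1 ?mulr0 //; move: h; rewrite eqxx.
  apply: measurable_funM; last exact: measurable_indic.
  apply: (measurableT_comp (@measurable_expR R)).
  by do 2 apply: measurableT_comp => //; exact: mphi.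
have VE : V phi0 = integral_rV (fun x => (psi x)%:E).
  by apply: eq_integral_rV => x; rewrite psiE.
have := Cvx_V hphi0; rewrite VE => /andP[V0 Voo].
have ip : integrable_rV psi by exact: ge0_integrable_rV.
by split => //; rewrite -lte_fin EFin_Rintegral_rV.
Qed.

End solution.

(** Since [x - e^(- s) z = e^(- s) (e^s x - z)], the Fokker-Planck kernel at time
    [s] is [ou_factor s] times the heat kernel of variance
    [e^(2 s) (1 - e^(- 2 s)) = ou_variance s], evaluated at [e^s x - z]. *)
Definition ou_variance s : R := expR (2 * s) - 1.
Definition ou_factor s : R := (Num.sqrt (2 * pi * (1 - expR (- (2 * s)))) ^+ n)^-1.

Lemma ou_variance_gt0 s : 0 < s -> 0 < ou_variance s.
Proof. by move=> s0; rewrite subr_gt0 -[ltLHS]expR0 ltr_expR mulr_gt0. Qed.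

Lemma ou_varianceE s : ou_variance s = expR s ^+ 2 * (1 - expR (- (2 * s))).
Proof.
by rewrite -expRM_natl mulrBr mulr1 -expRD subrr expR0.
Qed.

Lemma ou_time_gt0 s : 0 < s -> 0 < 1 - expR (- (2 * s)).
Proof. by move=> s0; rewrite subr_gt0 -[ltRHS]expR0 ltr_expR oppr_lt0 mulr_gt0. Qed.

Lemma ou_factor_gt0 s : 0 < s -> 0 < ou_factor s.
Proof.
move=> /ou_time_gt0 s0.
by rewrite invr_gt0 exprn_gt0// sqrtr_gt0 !mulr_gt0// pi_gt0.
Qed.

Section reduced.
Variables (phi0 : 'rV[R]_n -> \bar R) (psi : 'rV[R]_n -> R).
Hypothesis psiE : forall x, (psi x)%:E = expeR (- phi0 x).
Hypothesis psi_ge0 : forall x, 0 <= psi x.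
Hypothesis psi_int : integrable_rV psi.
Hypothesis psi_gt0 : 0 < Rintegral_rV psi.

Let u s x : R := ou_factor s * heat psi (ou_variance s) (expR s *: x).

Let u_gt0 s x : 0 < s -> 0 < u s x.
Proof.
move=> s0; apply: mulr_gt0; first exact: ou_factor_gt0.
by apply: heat_gt0 => //; exact: ou_variance_gt0.
Qed.

Lemma fp_formulaE s x : 0 < s -> fp_formula phi0 s x = (- ln (u s x))%:E.
Proof.
move=> s0; have v0 := ou_time_gt0 s0; have sg0 := ou_variance_gt0 s0.
rewrite /fp_formula EFinN -lne_EFin ?u_gt0//; congr (- lne _)%E.
rewrite EFinM EFin_Rintegral_rV; last first.
  by apply: convolve_integrable => //; exact: bounded_gauss.
rewrite -ge0_integral_rVZl ?(ltW (ou_factor_gt0 s0))//; last 2 first.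
- exact: integrable_rV_measurable (convolve_integrable psi_ge0 psi_int _ (bounded_gauss sg0)).
- by move=> z; rewrite mulr_ge0// gauss_ge0.
apply: eq_integral_rV => z; rewrite -psiE.
have c0 : (2 * pi * (1 - expR (- (2 * s)))) `^ (n%:R / 2) = (ou_factor s)^-1.
  have z0 : 0 <= 2 * pi * (1 - expR (- (2 * s))) :> R.
    by rewrite mulr_ge0 ?mulr_ge0 ?pi_ge0// ltW.
  by rewrite invrK (mulrC n%:R) powRrM powR12_sqrt// powR_mulrn ?sqrtr_ge0.
rewrite c0 inver invr_eq0 gt_eqF ?ou_factor_gt0// invrK -!EFinM.
set w := z.
have -> : expR (- (sqnorm (x - expR (- s) *: w) / (2 * (1 - expR (- (2 * s)))))) =
    gauss (ou_variance s) (expR s *: x - w).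
  rewrite /gauss ou_varianceE; congr (expR (- _)).
  have -> : x - expR (- s) *: w = expR (- s) *: (expR s *: x - w).
    by rewrite scalerBr scalerA -expRD addNr expR0 scale1r.
  by rewrite sqnormZ expRN; field; rewrite !gt_eqF ?expR_gt0.
by congr EFin; ring.
Qed.

Lemma measurable_scale (f : 'rV[R]_n -> R) (c : R) :
  measurable_rV f -> measurable_rV (fun x => f (c *: x)).
Proof.
move=> mf; have := @measurable_rV_affine R _ _ n c 0 _ mf.
by under eq_fun do rewrite addr0.
Qed.

Lemma ge0_integral_scale (f : 'rV[R]_n -> R) (c : R) : 0 < c ->
  measurable_rV f -> (forall x, 0 <= f x) ->
  integral_rV (fun x => (f (c *: x))%:E) = ((c ^- n)%:E * integral_rV (fun x => (f x)%:E))%E.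
Proof.
move=> c0 mf f0.
rewrite -(@ge0_integral_rV_affine _ _ c 0 (fun x => (f x)%:E)) => [|//||x].
- by apply: eq_integral_rV => x; rewrite addr0.
- by apply/measurable_EFinP.
- by rewrite lee_fin.
Qed.

Lemma expeR_fp_formula s x : 0 < s -> expeR (- fp_formula phi0 s x) = (u s x)%:E.
Proof. by move=> s0; rewrite fp_formulaE//= opprK lnK// posrE u_gt0. Qed.

(** The factors [e^(s n)] of the dilation and of [sqrt (ou_variance s)^n] cancel:
    the flow conserves mass. *)
Lemma V_fp_formula s : 0 < s -> V (fp_formula phi0 s) = (Rintegral_rV psi)%:E.
Proof.
move=> s0; have sg0 := ou_variance_gt0 s0; have es : 0 < expR s by exact: expR_gt0.
have mh := measurable_heat psi_ge0 psi_int sg0.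
have h0 x : 0 <= heat psi (ou_variance s) x by rewrite ltW// heat_gt0.
transitivity (integral_rV (fun x => (u s x)%:E)).
  by apply: eq_integral_rV => x; rewrite expeR_fp_formula.
rewrite (ge0_integral_rVZl (ltW (ou_factor_gt0 s0)) (measurable_scale (expR s) mh)
  (fun x => h0 (expR s *: x))).
rewrite (ge0_integral_scale es mh h0) integral_heat// -!EFinM; congr EFin.
rewrite /ou_factor ou_varianceE.
have v0 := ou_time_gt0 s0.
rewrite (_ : 2 * pi * (expR s ^+ 2 * (1 - expR (- (2 * s)))) =
  expR s ^+ 2 * (2 * pi * (1 - expR (- (2 * s))))); last by ring.
rewrite (sqrtrM _ (sqr_ge0 (expR s))) sqrtr_sqr gtr0_norm// exprMn.
have N0 : Num.sqrt (2 * pi * (1 - expR (- (2 * s)))) ^+ n != 0 :> R.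
  by rewrite gt_eqF// exprn_gt0// sqrtr_gt0 !mulr_gt0// pi_gt0.
have E0 : expR s ^+ n != 0 by rewrite gt_eqF// exprn_gt0.
by field; rewrite N0 E0.
Qed.

Variable p : R.
Hypothesis p0 : 0 < p.
Let q := p + 1.
Let q1 : 1 < q. Proof. by rewrite ltrDr. Qed.

(** The substitution [xi = e^s x] turns [p <x, y>] into [<xi, dual_point s y>], and
    its Jacobian [e^(- n s)], the mass and the power [q] of the prefactor make
    up [legendre_factor s]. *)
Definition dual_point s y : 'rV[R]_n := (p * expR (- s)) *: y.

Definition legendre_factor s : R :=
  (Rintegral_rV psi)^-1 * ou_factor s `^ q * expR s ^- n.

Local Notation T s y := (tilt psi q (dual_point s y) (ou_variance s)).

Lemma legendre_factor_gt0 s : 0 < s -> 0 < legendre_factor s.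
Proof.
move=> s0; rewrite !mulr_gt0 ?invr_gt0 ?exprn_gt0 ?expR_gt0//.
by rewrite powR_gt0 ?ou_factor_gt0.
Qed.

Lemma ln_legendre_factor s : 0 < s -> ln (legendre_factor s) =
  - ln (Rintegral_rV psi)
  - q * (n%:R / 2 * ln (2 * pi * (1 - expR (- (2 * s))))) - n%:R * s.
Proof.
move=> s0; have z0 : 0 < 2 * pi * (1 - expR (- (2 * s))) :> R.
  by rewrite !mulr_gt0 ?pi_gt0// ou_time_gt0.
rewrite /legendre_factor /ou_factor; move: (2 * pi * _) z0 => z z0.
have sz0 : 0 < Num.sqrt z by rewrite sqrtr_gt0.
have zn0 : 0 < (Num.sqrt z ^+ n)^-1 by rewrite invr_gt0 exprn_gt0.
have zq0 : 0 < (Num.sqrt z ^+ n)^-1 `^ q by rewrite powR_gt0.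
have V0 : 0 < (Rintegral_rV psi)^-1 by rewrite invr_gt0.
have en : 0 < expR s ^- n by rewrite invr_gt0 exprn_gt0// expR_gt0.
have lnI (a : R) : 0 < a -> ln a^-1 = - ln a by move=> a0; rewrite lnV.
rewrite (lnM (mulr_gt0 V0 zq0) en) (lnM V0 zq0) ln_powR.
rewrite !lnI ?exprn_gt0 ?expR_gt0// !lnXn ?expR_gt0// expRK.
have -> : ln (Num.sqrt z) = 2^-1 * ln z by rewrite -powR12_sqrt ?(ltW z0)// ln_powR.
by rewrite -(mulr_natr s) -(mulr_natr (_ * ln z)); field.
Qed.

Let T_scale s y x : 0 < s ->
  expR (p * dotp x y) * u s x `^ q = ou_factor s `^ q * T s y (expR s *: x).
Proof.
move=> s0; have sg0 := ou_variance_gt0 s0.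
have h0 := ltW (heat_gt0 psi_ge0 psi_int psi_gt0 (expR s *: x) sg0).
rewrite /u (powRM q (ltW (ou_factor_gt0 s0)) h0) /(tilt _ _ _ _ _).
rewrite /dual_point dotpZl dotpZr.
have -> : expR s * (p * expR (- s) * dotp x y) = (expR s * expR (- s)) * (p * dotp x y) by ring.
by rewrite -expRD subrr expR0 mul1r; ring.
Qed.

Lemma tilt_pos s y x : 0 < s -> 0 < T s y x.
Proof. by move=> s0; apply: tilt_gt0 => //; exact: ou_variance_gt0. Qed.

Lemma measurable_T s y : 0 < s -> measurable_rV (T s y).
Proof. by move=> s0; apply: measurable_tilt => //; exact: ou_variance_gt0. Qed.

Lemma lp_legendreE s y : 0 < s -> lp_legendre p (fp_formula phi0 s) y =
  (p^-1%:E * lne ((legendre_factor s)%:E *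
     laplace psi q (ou_variance s) (dual_point s y)))%E.
Proof.
move=> s0; rewrite /lp_legendre; congr (_ * lne _)%E.
have c0 := powR_ge0 (ou_factor s) q.
have mT := measurable_T y s0.
have T0 x : 0 <= T s y x by exact: ltW (tilt_pos y x s0).
have V0 : 0 <= (Rintegral_rV psi)^-1 by rewrite invr_ge0 ltW.
transitivity (integral_rV (fun x => ((Rintegral_rV psi)^-1 *
    (ou_factor s `^ q * T s y (expR s *: x)))%:E)).
  apply: eq_integral_rV => x; rewrite expeR_fp_formula// V_fp_formula// fp_formulaE//.
  rewrite inver gt_eqF// -EFinN -EFinD -!EFinM /= -?EFinM; congr EFin.
  rewrite -T_scale// opprK mulrDr expRD.
  have u0 := u_gt0 x s0.
  have -> : u s x `^ q = expR (p * ln (u s x)) * u s x.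
    by rewrite /powR gt_eqF// /q mulrDl mul1r expRD (lnK (u0 : _ \in Num.pos)).
  by field; rewrite gt_eqF.
have mTs := measurable_scale (expR s) mT.
have mcT : measurable_rV (fun x => ou_factor s `^ q * T s y (expR s *: x)).
  exact: measurable_funM.
rewrite (ge0_integral_rVZl V0 mcT (fun x => mulr_ge0 c0 (T0 (expR s *: x)))).
rewrite (ge0_integral_rVZl c0 mTs (fun x => T0 (expR s *: x))).
rewrite (ge0_integral_scale (expR_gt0 s) mT T0) !muleA -!EFinM.
by rewrite /legendre_factor.
Qed.

(** The equality persists where the integral diverges, because both sides are
    then zero: [fine +oo = 0], hence [ln 0 = 0] on the right. *)
Lemma fine_lp_legendre s y : 0 < s -> fine (lp_legendre p (fp_formula phi0 s) y) =
  p^-1 * ln (legendre_factor s * Rintegral_rV (T s y)).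
Proof.
move=> s0; rewrite lp_legendreE//; have A0 := legendre_factor_gt0 s0.
have pV : 0 < p^-1 by rewrite invr_gt0.
rewrite [Rintegral_rV _](_ : _ = fine (laplace psi q (ou_variance s) (dual_point s y)))//.
move: (legendre_factor s) A0 (laplace _ _ _ _) => A A0 [r||].
- rewrite -EFinM; have [r0|r0] := leP (A * r) 0.
    by rewrite le0_lneNy ?lee_fin// gt0_muleNy ?lte_fin//= ln0// mulr0.
  by rewrite lne_EFin.
- by rewrite gt0_muley ?lte_fin//= gt0_muley ?lte_fin//= mulr0 ln0// mulr0.
- by rewrite gt0_muleNy ?lte_fin//= gt0_muleNy ?lte_fin//= mulr0 ln0// mulr0.
Qed.

Lemma lp_legendre_lty s y : 0 < s ->
  (lp_legendre p (fp_formula phi0 s) y < +oo)%E ->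
  (laplace psi q (ou_variance s) (dual_point s y) < +oo)%E.
Proof.
move=> s0; rewrite lp_legendreE//; have A0 := legendre_factor_gt0 s0.
have pV : 0 < p^-1 by rewrite invr_gt0.
move: (legendre_factor s) A0 (laplace _ _ _ _) => A A0 [r||] //.
  by rewrite ltry.
by rewrite gt0_muley ?lte_fin//= gt0_muley ?lte_fin.
Qed.

Lemma Rintegral_T_gt0 s y : 0 < s ->
  (laplace psi q (ou_variance s) (dual_point s y) < +oo)%E ->
  integrable_rV (T s y) /\ 0 < Rintegral_rV (T s y).
Proof.
move=> s0 fin; have sg0 := ou_variance_gt0 s0.
have Ti := integrable_tilt psi_ge0 psi_int psi_gt0 q1 sg0 sg0 fin.
split => //; apply: (Rintegral_rV_gt0 psi_int Ti) => // x; have := tilt_pos y x s0.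
  exact: ltW.
by move=> /gt_eqF/eqP.
Qed.

Lemma lp_legendre_fin_num s y : 0 < s ->
  (laplace psi q (ou_variance s) (dual_point s y) < +oo)%E ->
  lp_legendre p (fp_formula phi0 s) y \is a fin_num.
Proof.
move=> s0 fin; have [Ti T0] := Rintegral_T_gt0 s0 fin.
rewrite lp_legendreE// -[laplace _ _ _ _](EFin_Rintegral_rV Ti) -EFinM lne_EFin//.
by rewrite mulr_gt0// legendre_factor_gt0.
Qed.

Lemma tilted_densityE s y x : 0 < s ->
  (laplace psi q (ou_variance s) (dual_point s y) < +oo)%E ->
  fine (tilted_density p y (fp_formula phi0 s) x) =
  expR s ^+ n / Rintegral_rV (T s y) * T s y (expR s *: x).
Proof.
move=> s0 fin; have [Ti T0] := Rintegral_T_gt0 s0 fin.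
have c0 : 0 < ou_factor s `^ q by rewrite powR_gt0// ou_factor_gt0.
have mT := measurable_T y s0.
have Tp z : 0 <= T s y z by exact: ltW (tilt_pos y z s0).
have E z : expeR ((p * dotp z y)%:E - (p + 1)%:E * fp_formula phi0 s z) =
    (ou_factor s `^ q * T s y (expR s *: z))%:E.
  rewrite fp_formulaE// -EFinM -EFinN -EFinD /= -T_scale// mulrN opprK expRD.
  by rewrite /powR gt_eqF ?u_gt0.
have D : tilted_density p y (fp_formula phi0 s) x =
    ((ou_factor s `^ q * T s y (expR s *: x))%:E /
     (ou_factor s `^ q * (expR s ^- n * Rintegral_rV (T s y)))%:E)%E.
  congr (_ / _)%E; first exact: E.
  transitivity (integral_rV (fun z => (ou_factor s `^ q * T s y (expR s *: z))%:E)).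
    by apply: eq_integral_rV.
  rewrite (ge0_integral_rVZl (ltW c0) (measurable_scale (expR s) mT)
    (fun x => Tp (expR s *: x))).
  by rewrite (ge0_integral_scale (expR_gt0 s) mT Tp) -(EFin_Rintegral_rV Ti) -!EFinM.
rewrite D inver gt_eqF ?mulr_gt0 ?invr_gt0 ?exprn_gt0 ?expR_gt0// -EFinM /=.
have E0 : expR s ^+ n != 0 by rewrite gt_eqF// exprn_gt0// expR_gt0.
by field; rewrite E0 !gt_eqF.
Qed.

End reduced.
End reduction.

(** * Fisher information *)

Section fisher.
Context {R : realType} {n : nat} (psi : 'rV[R]_n -> R).
Hypothesis psi_ge0 : forall x, 0 <= psi x.
Hypothesis psi_int : integrable_rV psi.
Hypothesis psi_gt0 : 0 < Rintegral_rV psi.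
Variable q : R.
Hypothesis q1 : 1 < q.
Variables (b : 'rV[R]_n) (s : R).
Hypothesis s0 : 0 < s.
Hypothesis fin : (laplace psi q s b < +oo)%E.
Local Notation T := (tilt psi q b s).
Local Notation T1 i := (tilt1 psi q i b s).
Local Notation T2 i := (tilt2 psi q i b s).
Local Notation T11 i := (tilt11 psi q i b s).
Local Notation Tt := (tiltt psi q b s).
Local Notation e_ i := (delta_mx 0 i : 'rV[R]_n).

Let q0 : 0 < q. Proof. exact: lt_trans q1. Qed.
Let Ti := integrable_tilt psi_ge0 psi_int psi_gt0 q1 s0 s0 fin.
Let Tsi := integrable_tilts psi_ge0 psi_int psi_gt0 q1 s0 fin.
Let T0 x : 0 < T x := @tilt_gt0 R n psi psi_ge0 psi_int psi_gt0 q b s x s0.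

(** With [P] the tilt and [L_i = d_i h / h], this is
    [int \sum_i (b_i + q L_i)^2 P], the cross term being eliminated by
    [b_i int P + q int L_i P = 0]. *)
Definition fisher_tilt : R := q ^+ 2 * \sum_i Rintegral_rV (T11 i) - sqnorm b * Rintegral_rV T.

Lemma Rintegral_fisher :
  let W x := \sum_i (b 0 i ^+ 2 * T x + (2 * q * b 0 i * T1 i x + q ^+ 2 * T11 i x)) in
  integrable_rV W /\ Rintegral_rV W = fisher_tilt.
Proof.
move=> W.
have i1 i := integrable_rVZl (b 0 i ^+ 2) Ti.
have i2 i : integrable_rV (fun x => 2 * q * b 0 i * T1 i x).
  by apply: integrable_rVZl; have [_ /(_ i)[]] := Tsi.
have i3 i : integrable_rV (fun x => q ^+ 2 * T11 i x).
  by apply: integrable_rVZl; have [_ /(_ i)[]] := Tsi.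
have i23 i := integrable_rVD (i2 i) (i3 i).
have i123 i := integrable_rVD (i1 i) (i23 i).
split; first exact: integrable_rV_sum.
rewrite Rintegral_rV_sum// /fisher_tilt mulr_sumr /sqnorm /dotp mulr_suml -sumrB.
apply: eq_bigr => i _; have [_ /(_ i)[j1 j2 j3]] := Tsi.
rewrite (Rintegral_rVD (i1 i) (i23 i)) (Rintegral_rVD (i2 i) (i3 i)).
rewrite (Rintegral_rVZl _ Ti) (Rintegral_rVZl _ j1) (Rintegral_rVZl _ j3).
have := Rintegral_tilt1 psi_ge0 psi_int psi_gt0 q1 s0 fin i.
move: (Rintegral_rV T) (Rintegral_rV (T1 i)) (Rintegral_rV (T11 i)) => H K Q E.
have -> : 2 * q * b 0 i * K = 2 * b 0 i * (b 0 i * H + q * K) - 2 * b 0 i ^+ 2 * H by ring.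
by rewrite E; ring.
Qed.

(** Both integrations by parts combined: the heat equation replaces [d_s h] by
    second derivatives, [int d_i (L_i P) = 0] replaces these by squares of the
    [L_i], and the squares make up the Fisher sum. *)
Lemma Rintegral_tiltt_fisher :
  2 * q * Rintegral_rV Tt =
  sqnorm b * Rintegral_rV T / q - (q - 1) / q * fisher_tilt
  + q * (n%:R / s) * Rintegral_rV T.
Proof.
have E := Rintegral_tiltt psi_ge0 psi_int psi_gt0 q1 s0 fin.
have -> : 2 * q * Rintegral_rV Tt = q * (2 * Rintegral_rV Tt) by ring.
rewrite E mulrDr mulrA; congr (_ + _).
rewrite /fisher_tilt mulr_sumr mulrBr mulrA mulr_sumr /sqnorm /dotp !(mulr_suml, mulr_sumr).
rewrite opprB addrCA -sumrN -!big_split /=.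
apply: eq_bigr => i _.
have := Rintegral_tilt1 psi_ge0 psi_int psi_gt0 q1 s0 fin i.
have := Rintegral_tilt2 psi_ge0 psi_int psi_gt0 q1 s0 fin i.
move: (Rintegral_rV T) (Rintegral_rV (T1 i)) (Rintegral_rV (T11 i)) (Rintegral_rV (T2 i)).
move=> H K Q S E2 E1.
have -> : S = - (b 0 i * K + (q - 1) * Q).
  by apply/eqP; rewrite -addr_eq0 addrC; apply/eqP.
have -> : K = - (b 0 i * H) / q.
  by apply: (mulfI (lt0r_neq0 q0)); rewrite mulrCA divff ?gt_eqF// mulr1; lra.
by field; rewrite gt_eqF.
Qed.

Let is_derive_ln_tilt (a c : R) i x : 0 < a -> 0 < c ->
  partial i (fun z => ln (c * T (a *: z))) x =
  a * (b 0 i + q * (heat1 psi i s (a *: x) / heat psi s (a *: x))).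
Proof.
move=> a0 c0; apply: deriveE_line.
have D := is_derive_tilt psi_ge0 psi_int psi_gt0 q i b (a *: x) (a * 0) s0.
rewrite mulr0 scale0r addr0 in D.
have Da : is_derive (0 : R) 1 (fun t : R => a * t) a.
  by apply: is_derive_eq; rewrite /GRing.scale/= ?(mulr0, addr0) mulr1.
have D0 : is_derive (a * 0) 1 (fun t : R => T (a *: x + t *: e_ i))
   (b 0 i * T (a *: x) + q * T1 i (a *: x)) by rewrite mulr0.
have D1 := is_derive1_comp (f := fun t : R => T (a *: x + t *: e_ i)) (g := fun t => a * t) D0 Da.
have D2 : is_derive (0 : R) 1 (fun t : R => c * T (a *: x + (a * t) *: e_ i)) _ :=
  is_deriveZ c D1.
have cT : 0 < c * T (a *: x + (a * 0) *: e_ i).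
  by rewrite mulr0 scale0r addr0 mulr_gt0.
have D3 := is_derive1_comp (f := @ln R) (g := fun t : R => c * T (a *: x + (a * t) *: e_ i))
  (is_derive1_ln cT) D2.
rewrite (_ : (fun t : R => _) =
  @ln R \o (fun t : R => c * T (a *: x + (a * t) *: e_ i))); last first.
  by apply/funext => t /=; rewrite scalerDr scalerA.
apply: (is_derive_eq D3); rewrite mulr0 scale0r addr0 /GRing.scale/= /(tilt1 _ _ _ _ _ _).
have TN0 : T (a *: x) != 0 by rewrite gt_eqF// T0.
move: (heat1 psi i s (a *: x) / heat psi s (a *: x)) (T (a *: x)) TN0 => L U U0.
by field; rewrite U0 gt_eqF.
Qed.

(** The logarithmic derivative of [P (a x)] in direction [i] is
    [a (b_i + q L_i)]; normalising constants disappear under [d_i log]. *)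
Lemma fisher_information_tilt (a : R) : 0 < a ->
  fisher_information (fun x => a ^+ n / Rintegral_rV T * T (a *: x)) =
  (a ^+ 2 * fisher_tilt / Rintegral_rV T)%:E.
Proof.
move=> a0; have [Wi WE] := Rintegral_fisher.
have H0 : 0 < Rintegral_rV T.
  apply: (Rintegral_rV_gt0 psi_int Ti) => // x; have := T0 x; first exact: ltW.
  by move=> /gt_eqF/eqP.
set c := a ^+ n / Rintegral_rV T.
have c0 : 0 < c by rewrite divr_gt0// exprn_gt0.
set W := (fun x : 'rV[R]_n => _) in Wi WE.
have Wai := integrable_rV_affine 0 a0 Wi.
transitivity (integral_rV (fun x => (c * a ^+ 2 * W (a *: x + 0))%:E)).
  apply: eq_integral_rV => x; congr EFin; rewrite addr0 /W /sqnorm /dotp mulr_sumr mulr_suml.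
  apply: eq_bigr => i _; rewrite mxE is_derive_ln_tilt// /(tilt11 _ _ _ _ _ _) /(tilt1 _ _ _ _ _ _).
  by move: (heat1 _ _ _ _ / _) (T (a *: x)) => L U; ring.
rewrite -(EFin_Rintegral_rV (integrable_rVZl _ Wai)) (Rintegral_rVZl _ Wai).
rewrite (Rintegral_rV_affine 0 a0 Wi) WE; congr EFin.
by rewrite /c; field; rewrite !gt_eqF// exprn_gt0.
Qed.

End fisher.

(** * The time derivative of the Legendre transform *)

Section conclusion.
Context {R : realType} {n : nat}.

Lemma differentiable_ln_comp (G : 'rV[R]_n -> R) (y m : 'rV[R]_n) (a c : R) :
  0 < a -> 0 < G y -> differentiable G y ->
  (forall v, 'D_v G y = dotp v m) ->
  differentiable (fun z => c * ln (a * G z)) y /\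
  forall v, 'D_v (fun z => c * ln (a * G z)) y = c / G y * dotp v m.
Proof.
move=> a0 G0 dG DG.
have aG : 0 < a * G y by rewrite mulr_gt0.
have dl : derivable (@ln R) (a * G y) 1 by apply: ex_derive; exact: is_derive1_ln.
have dF : differentiable (a *: G) y by exact: differentiableZ.
have dl' : differentiable (@ln R) ((a *: G) y) by exact/derivable1_diffP.
have dlF : differentiable (@ln R \o (a *: G)) y by exact: differentiable_comp.
rewrite (_ : (fun z => _) = c *: (@ln R \o (a *: G)))//.
split=> [|v]; first exact: differentiableZ.
rewrite deriveE; last exact: differentiableZ.
rewrite (diffZ c dlF)/= (diff_comp dF dl')/= (diff1E dl') (diffZ a dG)/= -deriveE// DG.
rewrite derive1E; have [_ ->] := is_derive1_ln aG.
by rewrite /GRing.scale/=; field; rewrite !gt_eqF.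
Qed.

Lemma continuous_near_dist (f : R -> R) (t e : R) : {for t, continuous f} -> 0 < e ->
  \forall u \near t, `|f u - f t| < e.
Proof.
move=> cf e0; have /cvgrPdist_lt/(_ _ e0) := cf.
by apply: filterS => u; rewrite distrC.
Qed.

Lemma is_derive_continuous (f : R -> R) (t l : R) : is_derive t 1 f l -> {for t, continuous f}.
Proof. by move=> [df _]; exact/differentiable_continuous/derivable1_diffP. Qed.

(** Here [E] stands for [e^t], [d] for the dimension, [N] for [|y|^2], [D] for
    [<y, m>] with [m] the first moment of the tilt, and [F], [H], [T] for the
    Fisher sum and the integrals of [P] and [P d_s h / h]. *)
Lemma time_derivative_algebra (p N D F H T d E : R) :
  0 < p -> 0 < H -> 0 < E -> E ^+ 2 - 1 != 0 ->
  2 * (p + 1) * T = (p / E) ^+ 2 * N * H / (p + 1) - (p + 1 - 1) / (p + 1) * F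
    + (p + 1) * (d / (E ^+ 2 - 1)) * H ->
  p^-1 * ((- ((p + 1) * d / (E ^+ 2 - 1)) - d) +
    (- (p / E) * D + (p + 1) * (2 * E ^+ 2) * T) / H) =
  p / (p + 1) * N - p^-1 / H * (p / E * D) - E ^+ 2 * F / H / (p + 1) + d.
Proof.
move=> p0 H0 E0 s0 TE.
have -> : (p + 1) * (2 * E ^+ 2) * T = E ^+ 2 * (2 * (p + 1) * T) by ring.
rewrite TE; field.
by rewrite s0 !gt_eqF// addr_gt0.
Qed.

End conclusion.

Theorem lemma6p5 (R : realType) (n : nat) (p : R) (hp : 0 < p)
    (phi0 : 'rV[R]_n -> \bar R) (hphi0 : Cvx phi0)
    (phi : R -> 'rV[R]_n -> \bar R) (hphi : fp_solution phi0 phi)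
    (t : R) (ht : 0 < t) (y : 'rV[R]_n)
    (hy : interior [set z | (lp_legendre p (phi t) z < +oo)%E] y) :
  [/\ (\forall s \near t, lp_legendre p (phi s) y \is a fin_num),
      derivable (fun s : R => fine (lp_legendre p (phi s) y)) t 1,
      differentiable (fun z => fine (lp_legendre p (phi t) z)) y
    & (derive1 (fun s : R => fine (lp_legendre p (phi s) y)) t)%:E =
      ((p / (p + 1) * sqnorm y
        - dotp y (grad (fun z => fine (lp_legendre p (phi t) z)) y))%:E
       - fisher_information (fun x => fine (tilted_density p y (phi t) x))
         / (p + 1)%:E
       + n%:R%:E)%E].
Proof.
have [psi [psiE psi0 psi_int psi_gt0]] := initial_density hphi0.
have phiE (s : R) : 0 < s -> phi s = fp_formula phi0 s := @fp_solution_formula _ _ _ _ hphi s.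
pose q := p + 1.
have q1 : 1 < q by rewrite ltrDr.
have q0 : 0 < q by rewrite (lt_trans _ q1).
pose sg := @ou_variance R.
have sg0 (s : R) : 0 < s -> 0 < sg s by exact: ou_variance_gt0.
pose be s : R := p * expR (- s).
pose k := be t; have k0 : 0 < k by rewrite mulr_gt0// expR_gt0.
pose b : 'rV[R]_n := k *: y.
pose A := legendre_factor psi p.
have fineE (s : R) z : 0 < s -> fine (lp_legendre p (phi s) z) =
    p^-1 * ln (A s * Rintegral_rV (tilt psi q (be s *: z) (sg s))).
  by move=> s0; rewrite phiE//; exact: fine_lp_legendre.
(* [y] is interior to the domain, so [b = k y] is interior to its dilate by [k] *)
have [e e0 fin] : exists2 e : R, 0 < e & forall c : 'rV[R]_n, `|c - b| <= e ->
    (laplace psi q (sg t) c < +oo)%E.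
  move: hy => /nbhs_ballP[r /= r0 hr].
  exists (k * (r / 2)) => [|c cb]; first by rewrite mulr_gt0// divr_gt0.
  have kc : dual_point p t (k^-1 *: c) = c.
    by rewrite /dual_point -/(be t) -/k scalerA divff ?scale1r// gt_eqF.
  rewrite -kc; apply: (lp_legendre_lty psiE psi0 psi_int psi_gt0 hp ht).
  rewrite -phiE//; apply: hr; rewrite -ball_normE /= distrC.
  have -> : k^-1 *: c - y = k^-1 *: (c - b).
    by rewrite scalerBr /b scalerA mulVf ?scale1r// gt_eqF.
  rewrite normrZ gtr0_norm ?invr_gt0// (@le_lt_trans _ _ (r / 2))//.
    by rewrite ler_pdivrMl.
  by rewrite ltr_pdivrMr// ltr_pMr// ltr1n.
(* the radius of the ball in which the moments of order [e] dominate *)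
pose d : R := e / (2 * n.+1%:R).
have d0 : 0 < d by rewrite divr_gt0// mulr_gt0// ltr0n.
have de : d <= e.
  by rewrite /d ler_pdivrMr ?mulr_gt0// ler_peMr ?(ltW e0)// -natrM ler1n.
(* the curves in the dual variable and in the heat time *)
pose be' s : R := - (p * expR (- s)).
pose sg' s : R := 2 * expR (2 * s).
have dbe (s : R) : is_derive s 1 be (be' s).
  by rewrite /be; apply: is_derive_eq; rewrite /be' /GRing.scale/=; ring.
have dsg (s : R) : is_derive s 1 sg (sg' s).
  by rewrite /sg /ou_variance; apply: is_derive_eq; rewrite /sg' /GRing.scale/=; ring.
have dsg' (s : R) : is_derive s 1 sg' (2 * sg' s).
  by rewrite /sg'; apply: is_derive_eq; rewrite /GRing.scale/=; ring.
(* neighbourhood of [t] on which the hypotheses of the differentiation along the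
   curve hold *)
pose K := `|be t| + sg' t + 1.
pose P (u : R) := [/\ 0 < u, `|be' u| <= K, `|sg' u| <= K,
  sg t / 2 <= sg u <= 2 * sg t & `|be u *: y - b| <= d].
have nearP : \forall u \near t, P u.
  have y1 : 0 < `|y| + 1 by rewrite ltr_wpDl.
  have H1 := continuous_near_dist (is_derive_continuous (dbe t)) (ltr01 : 0 < 1 :> R).
  have H2 := continuous_near_dist (is_derive_continuous (dbe t)) (divr_gt0 d0 y1).
  have H3 := continuous_near_dist (is_derive_continuous (dsg t)) (divr_gt0 (sg0 t ht) (ltr0n R 2)).
  have H4 := continuous_near_dist (is_derive_continuous (dsg' t)) (ltr01 : 0 < 1 :> R).
  near=> u.
  have h1 : `|be u - be t| < 1 by near: u.
  have h2 : `|be u - be t| < d / (`|y| + 1) by near: u.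
  have h3 : `|sg u - sg t| < sg t / 2 by near: u.
  have h4 : `|sg' u - sg' t| < 1 by near: u.
  have s'0 : 0 < sg' t by rewrite mulr_gt0// expR_gt0.
  split.
  - by near: u; exact: lt_nbhsr.
  - rewrite /be' normrN -/(be u) -(subrK (be t) (be u)) (le_trans (ler_normD _ _))// /K; lra.
  - rewrite -(subrK (sg' t) (sg' u)) (le_trans (ler_normD _ _))// /K (gtr0_norm s'0).
    by have := normr_ge0 (be t); lra.
  - by move: h3; have := sg0 t ht; rewrite ltr_distl => ? /andP[? ?]; apply/andP; split; lra.
  - rewrite /b /k -scalerBl normrZ (@le_trans _ _ (d / (`|y| + 1) * (`|y| + 1)))//.
      by apply: ler_pM => //; [exact: ltW|rewrite lerDl].
    by rewrite divfK// gt_eqF.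
have finP u : P u -> (laplace psi q (sg u) (dual_point p u y) < +oo)%E.
  move=> [u0 _ _ _ ud]; apply: (laplace_lty psi0 psi_int psi_gt0 q1 (sg0 t ht) (sg0 u u0)).
  by apply: fin; rewrite (le_trans ud).
have Pt : P t by exact: nbhs_singleton nearP.
have fint := finP t Pt.
pose M (s : R) : R := Rintegral_rV (tilt psi q (be s *: y) (sg s)).
have M0 u : P u -> 0 < M u.
  move=> Pu; have [u0 _ _ _ _] := Pu.
  by have [] := Rintegral_T_gt0 psi0 psi_int psi_gt0 hp u0 (finP u Pu).
have H0 := M0 t Pt.
pose m : 'rV[R]_n := \row_i Rintegral_rV (fun x => x 0 i * tilt psi q b (sg t) x).
pose Tt := Rintegral_rV (tiltt psi q b (sg t)).
have dM : is_derive t 1 M (be' t * dotp y m + q * sg' t * Tt).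
  have [r /= r0 hr] : nbhs_ball t P by apply/nbhs_ballP; exact: nearP.
  have hP u : `|u - t| < r -> P u by move=> ur; apply: hr; rewrite /ball/= distrC.
  have K0 : 0 <= K by have [_ h _ _ _] := Pt; exact: le_trans h.
  have s1 : 0 < sg t / 2 by rewrite divr_gt0// sg0.
  have s12 : sg t / 2 <= 2 * sg t by have := sg0 t ht; lra.
  have [_ E] := Rintegral_dotp_tilt psi0 psi_int psi_gt0 q1 e0 (sg0 t ht) fin y (sg0 t ht).
  rewrite /m -E.
  apply: (is_derive_Rintegral_tilt psi0 psi_int psi_gt0 q1 e0 (sg0 t ht) fin r0 s1 s12 K0) => //.
  by move=> u /hP[].
(* [ln (A s)] is differentiated through this explicit form; the
   equality [lAE] is for positive [s], hence the local argument in [dlp] *)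
pose v s : R := 1 - expR (- (2 * s)).
pose lA s : R := - ln (Rintegral_rV psi) - q * (n%:R / 2 * ln (2 * pi * v s)) - n%:R * s.
have lAE s : 0 < s -> ln (A s) = lA s.
  by move=> s0; rewrite /A ln_legendre_factor.
pose lp (s : R) : R := fine (lp_legendre p (phi s) y).
pose l : R := p^-1 * ((- (q * n%:R / sg t) - n%:R) +
  (be' t * dotp y m + q * sg' t * Tt) / M t).
have dlp : is_derive t 1 lp l.
  have v0 : 0 < v t by exact: ou_time_gt0.
  have z0 : 0 < 2 * pi * v t by rewrite !mulr_gt0// pi_gt0.
  have dz : is_derive t 1 (fun s => 2 * pi * v s) (2 * pi * (2 * expR (- (2 * t)))).
    by rewrite /v; apply: is_derive_eq; rewrite /GRing.scale/=; ring.
  have dlz := is_derive1_comp (f := @ln R) (g := fun s => 2 * pi * v s) (is_derive1_ln z0) dz.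
  have dlA : is_derive t 1 lA (- (q * n%:R / sg t) - n%:R).
    have -> : lA = (fun s => - ln (Rintegral_rV psi)
        - q * (n%:R / 2) * (@ln R \o (fun s => 2 * pi * v s)) s - n%:R * s).
      by apply/funext => s; rewrite /lA /=; ring.
    apply: is_derive_eq; rewrite /GRing.scale/= /sg ou_varianceE -/(v t).
    have -> : expR (- (2 * t)) = (expR t ^+ 2)^-1 by rewrite expRN -expRM_natl.
    move: (pi : R) (pi_gt0 R) => c c0.
    by field; rewrite !gt_eqF ?expR_gt0.
  have dlM := is_derive1_comp (f := @ln R) (g := M) (is_derive1_ln H0) dM.
  apply: (@near_eq_is_derive _ _ _ (fun s => p^-1 * (lA s + (@ln R \o M) s))).
    near=> s; have Ps : P s by near: s.
    have [s0 _ _ _ _] := Ps.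
    have As : 0 < A s by exact: legendre_factor_gt0.
    have Ms := M0 s Ps.
    by rewrite /lp (fineE s y s0) -(lAE s s0) -/(M s) (lnM As Ms).
  by apply: is_derive_eq; rewrite /l /GRing.scale/=; ring.
have [dG DG] : differentiable (fun z => Rintegral_rV (tilt psi q (k *: z) (sg t))) y /\
    forall w, 'D_w (fun z => Rintegral_rV (tilt psi q (k *: z) (sg t))) y = dotp w (k *: m).
  have [C HC] := Rintegral_tilt_taylor psi0 psi_int psi_gt0 q1 e0 (sg0 t ht) fin.
  apply: (@quadratic_remainder_differentiable _ _ _ _ _ (C * k ^+ 2) (d / k)).
    by rewrite divr_gt0.
  move=> w wk; rewrite scalerDr dotpZr -dotpZl.
  apply: (le_trans (HC (k *: w) _)).
    by rewrite normrZ gtr0_norm// mulrC -ltr_pdivlMr.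
  by rewrite normrZ gtr0_norm// exprMn mulrA.
have A0 : 0 < A t by exact: legendre_factor_gt0.
have [dL DL] := differentiable_ln_comp p^-1 A0 H0 dG DG.
have LE : (fun z => fine (lp_legendre p (phi t) z)) =
    (fun z => p^-1 * ln (A t * Rintegral_rV (tilt psi q (k *: z) (sg t)))).
  by apply/funext => z; rewrite fineE.
have gradE : dotp y (grad (fun z => fine (lp_legendre p (phi t) z)) y) =
    p^-1 / M t * (k * dotp y m).
  rewrite LE -dotpZr /dotp mulr_sumr; apply: eq_bigr => i _.
  by rewrite mxE /partial DL dotpC dotp_delta mulrCA.
have fisherE : fisher_information (fun x => fine (tilted_density p y (phi t) x)) =
    (expR t ^+ 2 * fisher_tilt psi q b (sg t) / M t)%:E.
  rewrite -(fisher_information_tilt psi0 psi_int psi_gt0 q1 (sg0 t ht) fint (expR_gt0 t)).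
  congr fisher_information; apply/funext => x; rewrite phiE//.
  exact: tilted_densityE.
split.
- near=> s; have Ps : P s by near: s.
  have [s0 _ _ _ _] := Ps.
  rewrite (phiE s s0).
  exact: (lp_legendre_fin_num psiE psi0 psi_int psi_gt0 hp s0 (finP s Ps)).
- by have [] := dlp.
- by rewrite LE.
- rewrite gradE fisherE derive1E; have [_ ->] := dlp.
  rewrite inver (gt_eqF q0) -EFinM -EFinN -!EFinD; congr EFin.
  have TE := Rintegral_tiltt_fisher psi0 psi_int psi_gt0 q1 (sg0 t ht) fint.
  have kE : k = p / expR t by rewrite /k /be expRN.
  have sE : sg t = expR t ^+ 2 - 1 by rewrite /sg /ou_variance expRM_natl.
  have sN0 : expR t ^+ 2 - 1 != 0 by rewrite -sE gt_eqF// sg0.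
  rewrite (_ : l = p^-1 * ((- ((p + 1) * n%:R / (expR t ^+ 2 - 1)) - n%:R) +
    (- (p / expR t) * dotp y m + (p + 1) * (2 * expR t ^+ 2) * Tt) / M t)); last first.
    by rewrite /l -sE -kE /sg' expRM_natl.
  rewrite kE; have := @time_derivative_algebra R p (sqnorm y) (dotp y m)
    (fisher_tilt psi q b (sg t)) (M t) Tt n%:R (expR t) hp H0 (expR_gt0 t) sN0.
  apply; rewrite -sE -kE -sqnormZ; exact: TE.
Unshelve. all: by end_near.
Qed.
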